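(* Let $p$ be a prime and $n\ge2$. The algebra $H(K//K_0(p^n))$ is an $(n+1)$-dimensional commutative algebra, generated by $\mathcal U_0,\mathcal Y_1,\dots,\mathcal Y_n$, with relations: $\mathcal Y_{n-r}^2=p^r\mathcal Y_{n-r}$ for $0\le r\le n-1$; $\mathcal Y_r*\mathcal Y_l=p^{n-r}\mathcal Y_l=\mathcal Y_l*\mathcal Y_r$ for $r\ge l$; $\mathcal U_0*\mathcal U_0=p^{n-1}(p-1)\mathcal U_0+p^n\mathcal Y_1$; $\mathcal U_0*\mathcal Y_r=p^{n-r}\mathcal U_0=\mathcal Y_r*\mathcal U_0$ for $1\le r\le n$; and $\mathcal U_0*(\mathcal U_0-p^n)*(\mathcal U_0+p^{n-1})=0$.
   Context: $G=\mathrm{GL}_2(\mathbb Q_p)$, $K=\mathrm{GL}_2(\mathbb Z_p)$, $K_0(p^n)=\{\begin{pmatrix}a&b\\c&d\end{pmatrix}\in K: c\in p^n\mathbb Z_p\}$. Functions in $C_c^\infty(G)$ are multiplied by convolution $f_1*f_2(h)=\int_Gf_1(g)f_2(g^{-1}h)\,dg$ with Haar measure giving $K_0(p^n)$ measure $1$. $H(K//K_0(p^n))$ is the algebra of $K_0(p^n)$-bi-invariant functions supported on $K$. $I$ is the characteristic function of $K_0(p^n)$ (the unit). With $y(t)=\begin{pmatrix}1&0\\t&1\end{pmatrix}$ and $w(1)=\begin{pmatrix}0&-1\\1&0\end{pmatrix}$: $\mathcal U_0$ is the characteristic function of $K_0(p^n)w(1)K_0(p^n)$, $\mathcal V_r$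 the characteristic function of $K_0(p^n)y(p^r)K_0(p^n)$ for $1\le r\le n-1$, $\mathcal Y_r=I+\sum_{j=r}^{n-1}\mathcal V_j$ for $1\le r\le n-1$, and $\mathcal Y_n=I$. *)

(* Defs.v *)
From HB Require Import structures.
From mathcomp Require Import all_boot all_order all_algebra.
From mathcomp Require Import all_classical all_reals all_analysis.
From mathcomp Require Import complex.

Set Implicit Arguments.
Unset Strict Implicit.
Unset Printing Implicit Defensive.

Import Order.TTheory GRing.Theory Num.Theory.

Local Open Scope classical_set_scope.
Local Open Scope ring_scope.

(** Z_p is the inverse limit of the rings Z/p^k: a p-adic integer is the
    sequence of its canonical residues x_k in [0, p^k). *)
Record padicZ (p : nat) (p_pr : prime p) := PadicZ {
  residue :> nat -> nat;
  residue_coherent : forall k, residue k = (residue k.+1 %% p ^ k)%N }.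

Section PadicInt.
Variables (p : nat) (p_pr : prime p).
Local Notation Z := (padicZ p_pr).

Implicit Types x y z : Z.

Lemma padicZP x y : x =1 y -> x = y.
Proof.
case: x y => [x hx] [y hy] /= /funext exy; move: hx hy; rewrite exy => hx hy.
by congr PadicZ; apply: Prop_irrelevance.
Qed.

HB.instance Definition _ := gen_eqMixin Z.
HB.instance Definition _ := gen_choiceMixin Z.

Lemma residue_mod x k : (x k %% p ^ k)%N = x k.
Proof. by rewrite residue_coherent modn_mod. Qed.

Lemma dvd_pS k : (p ^ k %| p ^ k.+1)%N.
Proof. exact: dvdn_exp2l. Qed.

Program Definition padic_of_nat m := @PadicZ p p_pr (fun k => m %% p ^ k)%N _.
Next Obligation. by move=> m k /=; rewrite modn_dvdm ?dvd_pS. Qed.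

Program Definition padic_add x y :=
  @PadicZ p p_pr (fun k => (x k + y k) %% p ^ k)%N _.
Next Obligation.
by move=> x y k /=; rewrite modn_dvdm ?dvd_pS // (residue_coherent x k) (residue_coherent y k) modnDm.
Qed.

Program Definition padic_mul x y :=
  @PadicZ p p_pr (fun k => (x k * y k) %% p ^ k)%N _.
Next Obligation.
by move=> x y k /=; rewrite modn_dvdm ?dvd_pS // (residue_coherent x k) (residue_coherent y k) modnMm.
Qed.

(* (p^k - 1) * x_k represents - x_k while staying in nat *)
Program Definition padic_opp x :=
  @PadicZ p p_pr (fun k => ((p ^ k).-1 * x k) %% p ^ k)%N _.
Next Obligation.
move=> x k /=; rewrite modn_dvdm ?dvd_pS // (residue_coherent x k) modnMmr.
have pk0 j : (0 < p ^ j)%N by rewrite expn_gt0 prime_gt0.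
apply/eqP; rewrite -(eqn_modDr (x k.+1)) -!mulSnr !prednK //.
by rewrite expnSr -mulnA !modnMr.
Qed.

Lemma padic_addA : associative padic_add.
Proof. by move=> x y z; apply: padicZP => k /=; rewrite modnDml modnDmr addnA. Qed.
Lemma padic_addC : commutative padic_add.
Proof. by move=> x y; apply: padicZP => k /=; rewrite addnC. Qed.
Lemma padic_add0 : left_id (padic_of_nat 0) padic_add.
Proof. by move=> x; apply: padicZP => k /=; rewrite mod0n add0n residue_mod. Qed.
Lemma padic_addN : left_inverse (padic_of_nat 0) padic_opp padic_add.
Proof.
move=> x; apply: padicZP => k /=; rewrite modnDml -mulSnr prednK.
  by rewrite modnMr mod0n.
by rewrite expn_gt0 prime_gt0.
Qed.
Lemma padic_mulA : associative padic_mul.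
Proof. by move=> x y z; apply: padicZP => k /=; rewrite modnMml modnMmr mulnA. Qed.
Lemma padic_mulC : commutative padic_mul.
Proof. by move=> x y; apply: padicZP => k /=; rewrite mulnC. Qed.
Lemma padic_mul1 : left_id (padic_of_nat 1) padic_mul.
Proof.
by move=> x; apply: padicZP => k /=; rewrite modnMml mul1n residue_mod.
Qed.
Lemma padic_mulDl : left_distributive padic_mul padic_add.
Proof.
move=> x y z; apply: padicZP => k /=.
by rewrite modnMml modnDml modnDmr mulnDl.
Qed.
Lemma padic_1neq0 : padic_of_nat 1 != padic_of_nat 0.
Proof.
apply/eqP => /(congr1 (fun x : Z => x 1%N)) /=.
by rewrite expn1 mod0n modn_small ?prime_gt1.
Qed.

HB.instance Definition _ := GRing.isZmodule.Build Z
  padic_addA padic_addC padic_add0 padic_addN.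
HB.instance Definition _ := GRing.Zmodule_isComNzRing.Build Z
  padic_mulA padic_mulC padic_mul1 padic_mulDl padic_1neq0.

Definition padic_unit : pred Z := fun x => `[< exists y : Z, y * x = 1 >].
Definition padic_inv (x : Z) : Z :=
  if x \in padic_unit then xget x [set y | y * x = 1] else x.

Lemma padic_mulVx : {in padic_unit, left_inverse 1 padic_inv *%R}.
Proof.
move=> x xU; rewrite /padic_inv xU; move: xU => /asboolP [y yx].
exact: (@xgetPex _ x [set y | y * x = 1] (ex_intro _ y yx)).
Qed.
Lemma padic_unitP (x y : Z) : y * x = 1 -> padic_unit x.
Proof. by move=> yx; apply/asboolP; exists y. Qed.
Lemma padic_inv_out : {in [predC padic_unit], padic_inv =1 id}.
Proof. by move=> x /negP xU; rewrite /padic_inv; case: ifP => // /xU. Qed.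

HB.instance Definition _ := GRing.ComNzRing_hasMulInverse.Build Z
  padic_mulVx padic_unitP padic_inv_out.

Lemma residue_dvdn (x : Z) k m : (k <= m)%N ->
  (p ^ k %| x m)%N = (x k == 0%N).
Proof.
move=> /subnK <-; elim: (m - k)%N => [|j IH].
  by rewrite add0n /dvdn residue_mod.
rewrite -IH addSn (residue_coherent x (j + k)) /dvdn.
by rewrite modn_dvdm // dvdn_exp2l // leq_addl.
Qed.

Lemma padic_mulf0 : GRing.integral_domain_axiom Z.
Proof.
move=> x y xy0; apply: contrapT => /negP; rewrite negb_or => /andP[x0 y0].
have nz (z : Z) : z != 0 -> exists k, z k != 0%N.
  move=> z0; apply: contrapT => h; move/eqP: z0; apply.
  apply: padicZP => k /=; rewrite mod0n; apply/eqP/negPn/negP => zk.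
  by apply: h; exists k.
have [a xa] := nz x x0; have [b yb] := nz y y0.
have := congr1 (fun z : Z => z (a + b)%N) xy0.
rewrite /= mod0n => /eqP; rewrite -/(dvdn _ _).
set u := x _; set v := y _.
have ux : ~~ (p ^ a %| u)%N by rewrite residue_dvdn // leq_addr.
have vy : ~~ (p ^ b %| v)%N by rewrite residue_dvdn // leq_addl.
have u0 : (0 < u)%N by case: (u) ux => //; rewrite dvdn0.
have v0 : (0 < v)%N by case: (v) vy => //; rewrite dvdn0.
rewrite pfactor_dvdn ?muln_gt0 ?u0 // lognM //.
move: ux vy; rewrite !pfactor_dvdn // -!ltnNge => ux vy.
by rewrite leqNgt -addSn leq_add // ltnW.
Qed.

HB.instance Definition _ :=
  GRing.ComUnitRing_isIntegral.Build Z padic_mulf0.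
End PadicInt.

(** Q_p = Frac(Z_p), with the p-adic topology: the sets x + p^m Z_p form a
    base of neighbourhoods of x. *)
Section PadicField.
Variables (p : nat) (p_pr : prime p).

Definition padicQ := {fraction padicZ p_pr}.

HB.instance Definition _ := GRing.Field.on padicQ.
HB.instance Definition _ := isPointed.Build padicQ 0.

Definition Zp_to_Qp (x : padicZ p_pr) : padicQ := tofrac x.

Definition Qp_open (U : set padicQ) := forall x, U x ->
  exists m : nat, forall z : padicZ p_pr, U (x + p%:R ^+ m * Zp_to_Qp z).

Lemma Qp_openT : Qp_open setT. Proof. by move=> x _; exists 0%N. Qed.

Lemma Qp_openI : setI_closed Qp_open.
Proof.
move=> U V oU oV x [/oU[a Ua] /oV[b Vb]].
exists (a + b)%N => z; split.
  have := Ua (p%:R ^+ b * z).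
  by rewrite /Zp_to_Qp rmorphM rmorphXn rmorph_nat mulrA exprD.
have := Vb (p%:R ^+ a * z).
by rewrite /Zp_to_Qp rmorphM rmorphXn rmorph_nat mulrA addnC exprD.
Qed.

Lemma Qp_open_bigU (I : Type) (f : I -> set padicQ) :
  (forall i, Qp_open (f i)) -> Qp_open (\bigcup_i f i).
Proof. by move=> of_ x [i _ /of_[m fm]]; exists m => z; exists i. Qed.

HB.instance Definition _ :=
  isOpenTopological.Build padicQ Qp_openT Qp_openI Qp_open_bigU.
End PadicField.

Section GL2Group.
Variable F : fieldType.

Record GL2 := MkGL2 { GL2val :> 'M[F]_2; GL2_unit : GL2val \in unitmx }.

HB.instance Definition _ := [isSub for GL2val].
HB.instance Definition _ := [Choice of GL2 by <:].

Definition GL2_one := MkGL2 (unitmx1 F 2).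
Lemma GL2_mul_subproof (g h : GL2) : g *m h \in unitmx.
Proof. by rewrite unitmx_mul !GL2_unit. Qed.
Definition GL2_mul (g h : GL2) := MkGL2 (GL2_mul_subproof g h).
Lemma GL2_inv_subproof (g : GL2) : invmx g \in unitmx.
Proof. by rewrite unitmx_inv GL2_unit. Qed.
Definition GL2_inv (g : GL2) := MkGL2 (GL2_inv_subproof g).

Lemma GL2_mulA : associative GL2_mul.
Proof. by move=> g h k; apply: val_inj; rewrite /= mulmxA. Qed.
Lemma GL2_mul1 : left_id GL2_one GL2_mul.
Proof. by move=> g; apply: val_inj; rewrite /= mul1mx. Qed.
Lemma GL2_mulx1 : right_id GL2_one GL2_mul.
Proof. by move=> g; apply: val_inj; rewrite /= mulmx1. Qed.
Lemma GL2_mulV : left_inverse GL2_one GL2_inv GL2_mul.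
Proof. by move=> g; apply: val_inj; rewrite /= mulVmx ?GL2_unit. Qed.
Lemma GL2_mulxV : right_inverse GL2_one GL2_inv GL2_mul.
Proof. by move=> g; apply: val_inj; rewrite /= mulmxV ?GL2_unit. Qed.

HB.instance Definition _ := isGroup.Build GL2
  GL2_mulA GL2_mul1 GL2_mulx1 GL2_mulV GL2_mulxV.
HB.instance Definition _ := isPointed.Build GL2 GL2_one.

Definition mx2 (a b c d : F) : 'M[F]_2 :=
  \matrix_(i, j) if i == 0 then (if j == 0 then a else b)
                 else (if j == 0 then c else d).

Lemma det_mx2 a b c d : \det (mx2 a b c d) = a * d - b * c.
Proof.
rewrite (expand_det_row _ ord0) !big_ord_recl big_ord0 /cofactor !det_mx11.
by rewrite !mxE /= addr0 expr0 mul1r expr1 mulN1r mulrN.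
Qed.

Lemma y_subproof t : mx2 1 0 t 1 \in unitmx.
Proof. by rewrite unitmxE det_mx2 mul0r subr0 mulr1 unitr1. Qed.
Definition y_elt t : GL2 := MkGL2 (y_subproof t).

Lemma w1_subproof : mx2 0 (-1) 1 0 \in unitmx.
Proof. by rewrite unitmxE det_mx2 mul0r sub0r mulr1 opprK unitr1. Qed.
Definition w1_elt : GL2 := MkGL2 w1_subproof.
End GL2Group.

(** GL_2(Q_p) carries the topology induced by M_2(Q_p); as Q_p is a topological
    field, inversion is continuous for it. *)
Section PadicGL2.
Variables (p : nat) (p_pr : prime p).

Definition GL2Qp := GL2 (padicQ p_pr).

HB.instance Definition _ := Group.on GL2Qp.
HB.instance Definition _ := Pointed.on GL2Qp.
HB.instance Definition _ := Topological.copy GL2Qp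
  (initial_topology (@GL2val (padicQ p_pr) : GL2Qp -> 'M[padicQ p_pr]_2)).

Definition borelG := g_sigma_algebraType (@open GL2Qp).

Definition GL2Zp : set GL2Qp := [set g | exists2 M : 'M[padicZ p_pr]_2,
  M \in unitmx & GL2val g = map_mx (@Zp_to_Qp p p_pr) M].

Definition K0 (n : nat) : set GL2Qp := [set g | GL2Zp g /\
  exists c : padicZ p_pr, (GL2val g) 1 0 = p%:R ^+ n * Zp_to_Qp c].

Definition double_coset (n : nat) (g : GL2Qp) : set GL2Qp :=
  [set h | exists k1 k2 : GL2Qp, [/\ K0 n k1, K0 n k2 & h = (k1 * g * k2)%g]].

Section Hecke.
Variable R : realType.
Local Notation C := R[i].
Local Notation fG := (GL2Qp -> C^o).

(* Radon regularity is automatic, GL_2(Q_p) being locally compact and second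
   countable. *)
Definition is_haar (mu : set borelG -> \bar R) : Prop :=
  [/\ forall (g : GL2Qp) (A : set borelG), measurable A ->
        mu [set (g * h)%g | h in A] = mu A,
      forall A : set GL2Qp, compact A -> (mu A < +oo)%E &
      mu setT <> 0%E].

Definition Cintegral (mu : {measure set borelG -> \bar R}) (f : GL2Qp -> C) :
    C :=
  Complex (Rintegral mu setT (fun g => complex.Re (f g)))
          (Rintegral mu setT (fun g => complex.Im (f g))).

Definition convol (mu : {measure set borelG -> \bar R}) (f1 f2 : fG) : fG :=
  fun h => Cintegral mu (fun g => f1 g * f2 (g^-1 * h)%g).

Definition heckeK (n : nat) : set fG := [set f |
  (forall k1 g k2 : GL2Qp, K0 n k1 -> K0 n k2 -> f (k1 * g * k2)%g = f g) /\
  (forall g, ~ GL2Zp g -> f g = 0)].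

Definition unitI (n : nat) : fG := \1_(K0 n).
Definition opU0 (n : nat) : fG := \1_(double_coset n (w1_elt _)).
Definition opV (n r : nat) : fG := \1_(double_coset n (y_elt (p%:R ^+ r))).
(* The sum is empty for r = n, so that opY n n = unitI n. *)
Definition opY (n r : nat) : fG := unitI n + \sum_(r <= j < n) opV n j.

End Hecke.
End PadicGL2.

(** Subspaces of an ambient vector space V that are algebras for a product
    [mul] defined on all of V, but well behaved only on the subspace. *)
Section Algebras.
Variables (C : fieldType) (V : lmodType C).
Implicit Types (S : set V) (mul : V -> V -> V) (one : V).

Definition is_subspace S : Prop :=
  S 0 /\ (forall (a : C) u v, S u -> S v -> S (a *: u + v)).

Definition has_dimension S (d : nat) : Prop := exists b : 'I_d -> V,
  [/\ forall i, S (b i),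
      forall c : 'I_d -> C, \sum_i c i *: b i = 0 -> forall i, c i = 0 &
      forall v, S v -> exists c : 'I_d -> C, v = \sum_i c i *: b i].

Definition is_algebra S mul one : Prop :=
  [/\ is_subspace S, S one & forall u v, S u -> S v -> S (mul u v)] /\
  [/\ forall (a : C) u v w, S u -> S v -> S w ->
        mul (a *: u + v) w = a *: mul u w + mul v w,
      forall (a : C) u v w, S u -> S v -> S w ->
        mul w (a *: u + v) = a *: mul w u + mul w v,
      forall u v w, S u -> S v -> S w -> mul u (mul v w) = mul (mul u v) w &
      forall u, S u -> mul one u = u /\ mul u one = u].

Definition is_commutative S mul : Prop :=
  forall u v, S u -> S v -> mul u v = mul v u.

(* The unital subalgebra generated by X is all of S. *)
Definition generates S mul one (X : set V) : Prop :=
  X `<=` S /\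
  forall S', is_subspace S' -> S' one ->
    (forall u v, S' u -> S' v -> S' (mul u v)) -> X `<=` S' -> S `<=` S'.

Definition is_algebra_morphism S mul one (A : algType C) (phi : V -> A) :=
  [/\ forall (a : C) u v, S u -> S v -> phi (a *: u + v) = a *: phi u + phi v,
      forall u v, S u -> S v -> phi (mul u v) = phi u * phi v &
      phi one = 1].

Definition hecke_relations (p n : nat) mul one (U : V) (Y : nat -> V) : Prop :=
  [/\ forall r, (0 <= r <= n - 1)%N ->
        mul (Y (n - r)%N) (Y (n - r)%N) = p%:R ^+ r *: Y (n - r)%N,
      forall r l, (1 <= l <= r)%N -> (r <= n)%N ->
        mul (Y r) (Y l) = p%:R ^+ (n - r) *: Y l /\
        mul (Y l) (Y r) = p%:R ^+ (n - r) *: Y l,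
      mul U U = (p%:R ^+ (n - 1) * (p%:R - 1)) *: U + p%:R ^+ n *: Y 1%N,
      forall r, (1 <= r <= n)%N ->
        mul U (Y r) = p%:R ^+ (n - r) *: U /\
        mul (Y r) U = p%:R ^+ (n - r) *: U &
      mul (mul U (U - p%:R ^+ n *: one)) (U + p%:R ^+ (n - 1) *: one) = 0].
End Algebras.

(* Main.v *)
From HB Require Import structures.
Require Import Defs.
From mathcomp Require Import all_boot all_order all_algebra.
From mathcomp Require Import all_classical all_reals all_analysis.
From mathcomp Require Import complex ring measurable_realfun.

Set Implicit Arguments.
Unset Strict Implicit.
Unset Printing Implicit Defensive.

Import Order.TTheory GRing.Theory Num.Theory.

Local Open Scope classical_set_scope.
Local Open Scope ring_scope.

(** For 0 <= k <= n the groups K_k = K_0(p^k), with K_0 = K, form a decreasing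
    chain, and the elements w(1), y(p), ..., y(p^n) represent the double cosets
    of K_0(p^n) in K: the coset of the k-th one is K_k minus K_(k+1) (all of K_n
    for k = n).  Hence the indicators d_0, ..., d_n of the K_k form a basis of
    the Hecke algebra, with U_0 = d_0 - d_1 and Y_k = d_k for k >= 1.  Since the
    K_k are nested groups, d_i * d_j = vol(K_max(i,j)) d_min(i,j), where
    vol(K_k) = p^(n-k) for k >= 1 and vol(K) = p^(n-1) (p + 1).  Every claim is
    then checked on this multiplication table; conversely the relations give
    u + y_1, y_1, ..., y_n the same table in any algebra. *)

(** * Units and digits in Z_p *)

Section PadicIntegers.
Variables (p : nat) (p_pr : prime p).
Local Notation Z := (padicZ p_pr).
Implicit Types x y : Z.

Lemma residueD x y k : (x + y) k = ((x k + y k) %% p ^ k)%N.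
Proof. by []. Qed.

Lemma residueM x y k : (x * y) k = ((x k * y k) %% p ^ k)%N.
Proof. by []. Qed.

Lemma residue_nat m k : (m%:R : Z) k = (m %% p ^ k)%N.
Proof.
elim: m => [|m IH]; first by [].
by rewrite mulrS residueD IH modnDmr modnDml add1n.
Qed.

Lemma residue1_mod x : (x 1 %% p)%N = x 1%N.
Proof. by have := residue_mod x 1; rewrite expn1. Qed.

(** Dividing by p shifts the sequence: y_k = x_(k+1) / p, an exact quotient because x_1 = 0 makes
    every x_(k+1) divisible by p. *)
Lemma p_dvd_padic x : x 1%N = 0%N -> exists y, x = p%:R * y.
Proof.
move=> x1; have pd k : (p %| x k.+1)%N.
  by rewrite -{1}(expn1 p) residue_dvdn // x1.
have coh k : (x k.+1 %/ p = (x k.+2 %/ p) %% p ^ k)%N.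
  by rewrite modn_divl mulnC -expnS -residue_coherent.
exists (@PadicZ p p_pr (fun k => x k.+1 %/ p)%N coh).
apply: padicZP => k; rewrite residueM residue_nat /=.
by rewrite modnMml mulnC divnK // -residue_coherent.
Qed.

(** If x_1 is nonzero, each x_k is prime to p^k; its inverse in [0, p^k) is unique, so these
    inverses are coherent and form a p-adic integer. *)
Lemma padic_unitE x : (x \is a GRing.unit) = (x 1%N != 0%N).
Proof.
apply/idP/idP => [xU|x1].
  apply/eqP => x1; have /(congr1 (fun z : Z => z 1%N)) := mulVr xU.
  by rewrite residueM x1 muln0 mod0n (residue_nat 1) expn1 modn_small //
    prime_gt1.
have cop k : coprime (x k) (p ^ k).
  case: k => [|k]; first by rewrite expn0 coprimen1.
  by rewrite coprime_sym coprime_pexpl // prime_coprime // -{1}(expn1 p)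
    residue_dvdn.
have inv k : exists y : nat, (y < p ^ k)%N && (y * x k == 1 %[mod p ^ k])%N.
  have pk0 : (0 < p ^ k)%N by rewrite expn_gt0 prime_gt0.
  (* A number congruent to 1 mod p^k and to 0 mod x_k is a multiple u x_k, and this u inverts
     x_k. *)
  have cE : (chinese (p ^ k) (x k) 1 0 = 1 %[mod p ^ k])%N.
    by rewrite chinese_modl // coprime_sym.
  have /dvdnP [u uE] : (x k %| chinese (p ^ k) (x k) 1 0)%N.
    by rewrite /dvdn chinese_modr ?mod0n // coprime_sym.
  by exists (u %% p ^ k)%N; rewrite ltn_mod pk0 modnMml -uE cE eqxx.
pose y k := xchoose (inv k).
have yP k : (y k < p ^ k)%N /\ (y k * x k = 1 %[mod p ^ k])%N.
  by have /andP[? /eqP] := xchooseP (inv k).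
have coh k : (y k = y k.+1 %% p ^ k)%N.
  have [yk ykE] := yP k; have [_ ySE] := yP k.+1.
  have y'E : (y k.+1 * x k = 1 %[mod p ^ k])%N.
    rewrite (residue_coherent x k) modnMmr -(modn_dvdm _ (dvd_pS p k)) ySE.
    by rewrite modn_dvdm ?dvd_pS.
  (* Uniqueness of inverses: y_(k+1) = y_(k+1) (y_k x_k) = y_k (y_(k+1) x_k) = y_k modulo p^k. *)
  rewrite -[LHS](modn_small yk) -[in RHS](muln1 (y k.+1)) -modnMmr -ykE modnMmr.
  by rewrite mulnCA -modnMmr y'E modnMmr muln1.
apply: (@padic_unitP _ _ _ (PadicZ p_pr coh)).
by apply: padicZP => k; rewrite residueM (residue_nat 1) /=; case: (yP k).
Qed.

Lemma padic_unitDp x z j : (0 < j)%N ->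
  (x + p%:R ^+ j * z \is a GRing.unit) = (x \is a GRing.unit).
Proof.
case: j => // j _; rewrite !padic_unitE exprS -mulrA residueD residueM
  residue_nat !expn1 modnn mul0n mod0n addn0.
by rewrite residue1_mod.
Qed.

Lemma padic_nonunit x : x \isn't a GRing.unit -> exists y, x = p%:R * y.
Proof. by rewrite padic_unitE negbK => /eqP /p_dvd_padic. Qed.

Lemma padic_digit x : exists2 i, (i < p)%N & exists y, x = i%:R + p%:R * y.
Proof.
exists (x 1%N); first by rewrite -[X in (X < _)%N]residue1_mod ltn_mod
  prime_gt0.
have [|y yE] := @p_dvd_padic (x - (x 1%N)%:R); last by exists y;
  rewrite -yE addrC subrK.
apply/eqP; have := residueD (x - (x 1%N)%:R) (x 1%N)%:R 1.
rewrite subrK residue_nat expn1 modnDmr -{1}[x 1%N]residue1_mod => /esym/eqP.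
by rewrite -[X in (_ == X %[mod _])%N]add0n eqn_modDr residue1_mod mod0n.
Qed.

Lemma padic_p_neq0 : p%:R != 0 :> Z.
Proof.
apply/eqP => /(congr1 (fun z : Z => z 2%N)); rewrite residue_nat modn_small.
  by move=> p0; have := prime_gt0 p_pr; rewrite lt0n => /eqP; apply;
    rewrite p0 /= mod0n.
by rewrite -{1}(expn1 p) ltn_exp2l ?prime_gt1.
Qed.

Lemma padic_digit_inj (i j : nat) y : (i < p)%N -> (j < p)%N ->
  i%:R - j%:R = p%:R * y -> i = j.
Proof.
move=> ip jp /eqP; rewrite subr_eq addrC => /eqP /(congr1 (fun z : Z => z 1%N)).
rewrite residueD residueM !residue_nat expn1 modnn mul0n mod0n addn0 modn_mod.
by rewrite !modn_small.
Qed.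

End PadicIntegers.

(** * The groups K_0(p^k) and their cosets *)

HB.instance Definition _ (p : nat) (p_pr : prime p) :=
  GRing.RMorphism.copy (@Zp_to_Qp p p_pr) (@tofrac (padicZ p_pr)).

Section Mx2.
Variable F : fieldType.
Implicit Types a b c d : F.

Lemma mx2_eta (A : 'M[F]_2) : A = mx2 (A 0 0) (A 0 1) (A 1 0) (A 1 1).
Proof.
apply/matrixP => i j; rewrite mxE.
by case: i => [[|[|?]] ?] //=; case: j => [[|[|?]] ?] //=; congr (A _ _);
  apply: val_inj.
Qed.

Lemma mx2_mul a b c d a' b' c' d' :
  mx2 a b c d *m mx2 a' b' c' d' =
  mx2 (a * a' + b * c') (a * b' + b * d') (c * a' + d * c') (c * b' + d * d').
Proof.
by rewrite [LHS]mx2_eta; congr mx2;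
  rewrite !mxE !big_ord_recl big_ord0 !mxE /= addr0.
Qed.
End Mx2.

(* Junk value 1 when the determinant is not a unit of Z_p *)
HB.lock Definition glz (p : nat) (p_pr : prime p) (a b c d : padicZ p_pr) :
    GL2Qp p_pr :=
  insubd (1%g : GL2Qp p_pr)
    (mx2 (Zp_to_Qp a) (Zp_to_Qp b) (Zp_to_Qp c) (Zp_to_Qp d)).
Arguments glz {p p_pr} (a b c d)%_R.

Section LowerLevel.
Variables (p : nat) (p_pr : prime p).
Local Notation Z := (padicZ p_pr).
Local Notation G := (GL2Qp p_pr).
Local Notation iota := (@Zp_to_Qp p p_pr).
Local Notation P := (p%:R : Z).
Local Notation K0 := (@K0 p p_pr).
Implicit Types (a b c d : Z) (g h : G).

Lemma iota_inj : injective iota.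
Proof. by move=> x y /eqP; rewrite /Zp_to_Qp tofrac_eq => /eqP. Qed.

Lemma iotaM x y : iota (x * y) = iota x * iota y.
Proof. exact: rmorphM. Qed.

Lemma iotaD x y : iota (x + y) = iota x + iota y.
Proof. exact: rmorphD. Qed.

Lemma iota_p n : iota (P ^+ n) = p%:R ^+ n.
Proof. by rewrite rmorphXn rmorph_nat. Qed.

Lemma val_glz a b c d : a * d - b * c \is a GRing.unit ->
  GL2val (glz a b c d) = mx2 (iota a) (iota b) (iota c) (iota d).
Proof.
move=> u; rewrite glz.unlock [LHS]insubdK // unfold_in unitmxE det_mx2.
by rewrite -!rmorphM -rmorphB; apply: rmorph_unit.
Qed.

Lemma glz_eq a b c d g : a * d - b * c \is a GRing.unit ->
  GL2val g = mx2 (iota a) (iota b) (iota c) (iota d) -> g = glz a b c d.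
Proof. by move=> u e; apply: val_inj; rewrite /= val_glz. Qed.

Lemma val_mulGL2 g h : GL2val (g * h)%g = GL2val g *m GL2val h.
Proof. by []. Qed.

Lemma glz_mul a b c d a' b' c' d' :
  a * d - b * c \is a GRing.unit -> a' * d' - b' * c' \is a GRing.unit ->
  (glz a b c d * glz a' b' c' d')%g =
  glz (a * a' + b * c') (a * b' + b * d') (c * a' + d * c') (c * b' + d * d').
Proof.
move=> u u'; apply: glz_eq.
  suff -> : (a * a' + b * c') * (c * b' + d * d') -
    (a * b' + b * d') * (c * a' + d * c') =
      (a * d - b * c) * (a' * d' - b' * c').
    by rewrite unitrM u.
  by ring.
by rewrite val_mulGL2 !val_glz // mx2_mul !rmorphD !rmorphM.
Qed.

Lemma glz1 : (1%g : G) = glz 1 0 0 1.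
Proof.
apply: glz_eq; first by rewrite mul0r subr0 mulr1 unitr1.
by rewrite [GL2val 1%g]mx2_eta !mxE /= rmorph0 rmorph1.
Qed.

Lemma glz_inv a b c d : a * d - b * c \is a GRing.unit ->
  let e := (a * d - b * c)^-1 in
  (glz a b c d)^-1%g = glz (e * d) (- (e * b)) (- (e * c)) (e * a).
Proof.
move=> u e; have eu : (a * d - b * c) * e = 1 by rewrite mulrV.
apply: mulg1_eq; rewrite glz_mul //; last first.
  suff -> : e * d * (e * a) - - (e * b) * - (e * c) = e by rewrite unitrV.
  rewrite -[RHS]mul1r -eu; by ring.
by rewrite glz1; congr glz; rewrite -?eu; ring.
Qed.

Lemma glz_K0 n a b c d : a * d - b * c \is a GRing.unit ->
  K0 n (glz a b c d) <-> exists c', c = P ^+ n * c'.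
Proof.
move=> u; split=> [[_ [c' e]]|[c' e]].
  exists c'; apply: iota_inj; rewrite iotaM iota_p -e val_glz //.
  by rewrite mxE.
split.
  exists (\matrix_(i, j) if i == 0 then (if j == 0 then a else b)
                 else (if j == 0 then c else d)).
    rewrite unitmxE (expand_det_row _ ord0) !big_ord_recl big_ord0 /cofactor
      !det_mx11.
    by rewrite !mxE /= addr0 expr0 mul1r expr1 mulN1r mulrN.
  by rewrite val_glz //; apply/matrixP => i j; rewrite !mxE; do 2 case: ifP.
by exists c'; rewrite val_glz // mxE /= e iotaM iota_p.
Qed.

(** A normal form over Z_p: it turns later membership questions into polynomial identities for
    [ring]. *)
Lemma K0E n g : K0 n g -> exists a b c d,
  a * d - b * (P ^+ n * c) \is a GRing.unit /\ g = glz a b (P ^+ n * c) d.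
Proof.
move=> [[M Mu gE] [c cE]].
have Mc : M 1 0 = P ^+ n * c.
  by apply: iota_inj; rewrite iotaM iota_p -cE gE mxE.
have u : M 0 0 * M 1 1 - M 0 1 * (P ^+ n * c) \is a GRing.unit.
  move: Mu; rewrite unitmxE (expand_det_row _ ord0) !big_ord_recl big_ord0
    /cofactor !det_mx11.
  rewrite !mxE /= addr0 expr0 mul1r expr1 mulN1r mulrN -Mc.
  have -> : lift 0 0 = 1 :> 'I_2 by apply: val_inj.
  have -> : lift 1 0 = 0 :> 'I_2 by apply: val_inj.
  by [].
exists (M 0 0), (M 0 1), c, (M 1 1); split => //; apply: glz_eq => //.
by rewrite gE -Mc [LHS]mx2_eta !mxE.
Qed.

Lemma K01 n : K0 n 1%g.
Proof.
rewrite glz1; apply/glz_K0; first by rewrite mul0r subr0 mulr1 unitr1.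
by exists 0; rewrite mulr0.
Qed.

Lemma K0M n g h : K0 n g -> K0 n h -> K0 n (g * h)%g.
Proof.
move=> /K0E[a [b [c [d [u ->]]]]] /K0E[a' [b' [c' [d' [u' ->]]]]].
rewrite glz_mul //; apply/glz_K0; last by exists (c * a' + d * c'); ring.
suff -> : (a * a' + b * (P ^+ n * c')) * (P ^+ n * c * b' + d * d') -
    (a * b' + b * d') * (P ^+ n * c * a' + d * (P ^+ n * c')) =
    (a * d - b * (P ^+ n * c)) * (a' * d' - b' * (P ^+ n * c')).
  by rewrite unitrM u.
by ring.
Qed.

Lemma K0V n g : K0 n g -> K0 n g^-1%g.
Proof.
move=> /K0E[a [b [c [d [u ->]]]]].
rewrite glz_inv //; set e := _^-1; apply/glz_K0; last by exists (- (e * c));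
  ring.
have eu : (a * d - b * (P ^+ n * c)) * e = 1 by rewrite mulrV.
suff -> : e * d * (e * a) - - (e * b) * - (e * (P ^+ n * c)) =
    (a * d - b * (P ^+ n * c)) * e * e by rewrite eu mul1r unitrV.
by ring.
Qed.

Lemma K0_le m n g : (m <= n)%N -> K0 n g -> K0 m g.
Proof.
move=> mn [gK [c e]]; split=> //; exists (P ^+ (n - m) * c).
by rewrite e iotaM iota_p mulrA -exprD subnKC.
Qed.

(** For n > 0, a d is the determinant plus a multiple of p. *)
Lemma K0_diag_unit n a b c d : (0 < n)%N ->
  a * d - b * (P ^+ n * c) \is a GRing.unit ->
  (a \is a GRing.unit) && (d \is a GRing.unit).
Proof.
move=> n0 u; rewrite -unitrM.
suff -> : a * d = a * d - b * (P ^+ n * c) + P ^+ n * (b * c) by rewrite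
  padic_unitDp.
by ring.
Qed.

(** * Representatives y(c) and w(1) of cosets and double cosets *)

Definition yZ c : G := y_elt (iota c).
Arguments yZ c%_R.

Lemma yZE c : yZ c = glz 1 0 c 1.
Proof.
apply: glz_eq; first by rewrite mul0r subr0 mulr1 unitr1.
by rewrite rmorph0 rmorph1.
Qed.

Lemma w1_eltE : (w1_elt _ : G) = glz 0 (-1) 1 0.
Proof.
apply: glz_eq; first by rewrite mul0r sub0r mulr1 opprK unitr1.
by rewrite rmorph0 rmorphN rmorph1.
Qed.

Lemma yZ_K0 n c : K0 n (yZ c) <-> exists c', c = P ^+ n * c'.
Proof. by rewrite yZE; apply: glz_K0; rewrite mul0r subr0 mulr1 unitr1. Qed.

Lemma y_elt_pK0 j k : K0 j (y_elt (p%:R ^+ k)) <-> (j <= k)%N.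
Proof.
rewrite -iota_p -/(yZ _) yZ_K0; split=> [[c e]|jk]; last first.
  by exists (P ^+ (k - j)); rewrite -exprD subnKC.
rewrite leqNgt; apply/negP => kj.
(* If k < j, cancelling p^k leaves 1 = p^(j-k) c, and a multiple of p is no unit. *)
have /mulfI : P ^+ k != 0 by rewrite expf_neq0 // padic_p_neq0.
move/(_ 1 (P ^+ (j - k) * c)); rewrite mulr1 mulrA -exprD subnKC;
  last exact: ltnW.
move/(_ e) => e1; have := unitr1 Z.
by rewrite e1 -[_ * c]add0r padic_unitDp ?subn_gt0 // unitr0.
Qed.

Lemma w1_K0 j : K0 j (w1_elt _) <-> j = 0%N.
Proof.
have u : 0 * 0 - (-1) * 1 \is a @GRing.unit Z by rewrite mul0r sub0r mulr1
  opprK unitr1.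
rewrite w1_eltE glz_K0 //; split=> [[c e]|->]; last by exists 1; rewrite mulr1.
case: j e => // j e; have := unitr1 Z.
by rewrite e -[_ * c]add0r padic_unitDp // unitr0.
Qed.

(* Left multiplication by y(p^j i)^-1 subtracts i times the top-left entry
   from the p^j-digit of the bottom-left entry *)
Lemma y_mulV_K0 j (i : nat) a b c d : 
  a * d - b * (P ^+ j * c) \is a GRing.unit ->
  K0 j.+1 ((yZ (P ^+ j * i%:R))^-1 * glz a b (P ^+ j * c) d)%g <->
  exists c', c - i%:R * a = P * c'.
Proof.
move=> u; have u1 : 1 * 1 - 0 * (P ^+ j * i%:R) \is a GRing.unit.
  by rewrite mul0r subr0 mulr1 unitr1.
have -> : ((yZ (P ^+ j * i%:R))^-1 = glz 1 0 (- (P ^+ j * i%:R)) 1)%g.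
  by rewrite yZE glz_inv // mul0r subr0 mulr1 invr1 !mul1r oppr0.
rewrite glz_mul //; last by rewrite mul0r subr0 mulr1 unitr1.
rewrite glz_K0; last by congr (_ \is a _): u; ring.
have P0 : P ^+ j != 0 by rewrite expf_neq0 // padic_p_neq0.
split=> [[c' e]|[c' e]]; exists c'.
  apply: (mulfI P0); rewrite mulrA -exprSr -e; by ring.
by rewrite exprSr -mulrA -e; ring.
Qed.

(** The index i is the first p-adic digit of c / a, which makes sense because a is a unit for j >
    0. *)
Lemma K0_coset j g : (0 < j)%N -> K0 j g ->
  exists2 i, (i < p)%N & K0 j.+1 ((yZ (P ^+ j * i%:R))^-1 * g)%g.
Proof.
move=> j0 /K0E[a [b [c [d [u ->]]]]].
have /andP[au _] := K0_diag_unit j0 u.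
have [i ip [c' e]] := padic_digit (c / a).
exists i => //; apply/y_mulV_K0 => //; exists (c' * a).
by rewrite -{1}(mulrVK au c) e; ring.
Qed.

(** K / K_0(p) is the projective line over F_p: the first column of g gives the point c / a, and
    w(1) is the point at infinity, reached when p divides a. *)
Lemma K0_coset0 g : K0 0 g ->
  (exists2 i, (i < p)%N & K0 1 ((yZ i%:R)^-1 * g)%g) \/
  K0 1 ((w1_elt _)^-1 * g)%g.
Proof.
move=> /K0E[a [b [c [d [u ->]]]]].
have [au|/padic_nonunit [a' aE]] := boolP (a \is a GRing.unit); [left|right].
  have [i ip [c' e]] := padic_digit (c / a).
  exists i => //; rewrite -[i%:R]mul1r -(expr0 P); apply/y_mulV_K0 => //;
    exists (c' * a).
  by rewrite -{1}(mulrVK au c) e; ring.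
have w1u : 0 * 0 - (-1) * 1 \is a @GRing.unit Z by rewrite mul0r sub0r mulr1
  opprK unitr1.
have wE : ((w1_elt _ : G)^-1 = glz 0 1 (-1) 0)%g.
  by rewrite w1_eltE glz_inv // mul0r sub0r mulr1 opprK invr1 !mul1r opprK.
have wu : 0 * 0 - 1 * (-1) \is a @GRing.unit Z by rewrite mul0r sub0r mulrN
  mulr1 opprK unitr1.
rewrite wE (glz_mul wu u); apply/glz_K0; last by exists (- a'); rewrite aE;
  ring.
by congr (_ \is a _): u; ring.
Qed.

Lemma y_coset_disjoint j (i i' : nat) : (i < p)%N -> (i' < p)%N ->
  K0 j.+1 ((yZ (P ^+ j * i%:R))^-1 * yZ (P ^+ j * i'%:R))%g ->
  i = i'.
Proof.
move=> ip i'p; rewrite (yZE (_ * i'%:R)) y_mulV_K0; last first.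
  by rewrite mul0r subr0 mulr1 unitr1.
by rewrite mulr1 => -[c' e]; rewrite (padic_digit_inj i'p ip e).
Qed.

(** The lower-left entry of y(i)^-1 w(1) is 1, which p does not divide. *)
Lemma w1_coset_disjoint (i : nat) :
  ~ K0 1 ((yZ i%:R)^-1 * w1_elt _)%g.
Proof.
have u : 0 * 0 - (-1) * (P ^+ 0 * 1) \is a @GRing.unit Z.
  by rewrite mul0r sub0r !mulr1 opprK unitr1.
have := y_mulV_K0 i u; rewrite expr0 !mul1r mulr0 subr0 -w1_eltE => -> [c e].
have := unitr1 Z.
by rewrite e -[_ * c]add0r -(expr1 P) padic_unitDp // unitr0.
Qed.

(** Index n stands for the trivial double coset, as y(p^n) lies in K_n. *)
Definition coset_rep j : G := if j == 0%N then w1_elt _ else y_elt (p%:R ^+ j).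

Lemma coset_rep_K0 i j : K0 i (coset_rep j) <-> (i <= j)%N.
Proof.
rewrite /coset_rep; case: eqP => [->|_]; last exact: y_elt_pK0.
by rewrite w1_K0 leqn0; split=> [->//|/eqP].
Qed.

(** Outside K_(j+1) the lower-left entry is p^j c with c a unit. Dividing by units then factors g
    explicitly around the representative; the outer factors are upper triangular, hence in every
    K_0(p^n). *)
Lemma K0_shell n j g : K0 j g -> ~ K0 j.+1 g -> double_coset n (coset_rep j) g.
Proof.
move=> /K0E[a [b [c [d [u ->]]]]]; rewrite glz_K0 // => nc.
have cu : c \is a GRing.unit.
  apply: contrapT => /negP /padic_nonunit[c' e]; apply: nc; exists c'.
  by rewrite e exprSr mulrA.
have cV : c / c = 1 by rewrite mulrV.
rewrite /coset_rep; have [j0|/eqP] := eqVneq j 0%N.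
  move: u; rewrite {nc} j0 !mul1r => u.
  have u1 : 1 * 1 - (a / c) * 0 \is a GRing.unit by rewrite mulr0 subr0 mulr1
    unitr1.
  have u2 : c * ((a * d - b * c) / c) - d * 0 \is a GRing.unit.
    by rewrite mulr0 subr0 mulrCA cV mulr1.
  (* Bruhat decomposition of a matrix whose lower-left entry is a unit. *)
  exists (glz 1 (a / c) 0 1), (glz c d 0 ((a * d - b * c) / c)); split.
  - by apply/glz_K0 => //; exists 0; rewrite mulr0.
  - by apply/glz_K0 => //; exists 0; rewrite mulr0.
  have wu : 0 * 0 - (-1) * 1 \is a @GRing.unit Z by rewrite mul0r sub0r mulr1
    opprK unitr1.
  have u3 : a / c * 0 - (-1) * 1 \is a GRing.unit.
    by rewrite mulr0 sub0r mulr1 opprK unitr1.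
  have -> : (glz 1 (a / c) 0 1 * w1_elt _ = glz (a / c) (-1) 1 0)%g.
    by rewrite w1_eltE (glz_mul u1 wu); congr glz; ring.
  rewrite (glz_mul u3 u2); congr glz; rewrite ?mul1r ?mulr0 ?mul0r ?addr0 //.
    by rewrite divrK.
  transitivity (b * (c / c)); first by rewrite cV mulr1.
  by ring.
move=> /eqP; rewrite -lt0n => j0.
have /andP[au du] := K0_diag_unit j0 u.
have aV : a / a = 1 by rewrite mulrV.
have u1 : (a / c) * 1 - 0 * 0 \is a GRing.unit.
  by rewrite mulr0 subr0 mulr1 unitrM unitrV au.
have u2 : c * ((a * d - b * (P ^+ j * c)) / a) - (b * c / a) * 0 \is a
  GRing.unit.
  by rewrite mulr0 subr0 !unitrM cu u unitrV.
(* The diagonal factor turns y(p^j) into the matrix with rows (a/c, 0) and (p^j, 1); the second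
   factor then restores the first column (a, p^j c), its other entries being solved for b and d. *)
exists (glz (a / c) 0 0 1),
  (glz c (b * c / a) 0 ((a * d - b * (P ^+ j * c)) / a)); split.
- by apply/glz_K0 => //; exists 0; rewrite mulr0.
- by apply/glz_K0 => //; exists 0; rewrite mulr0.
have yu : 1 * 1 - 0 * P ^+ j \is a GRing.unit by rewrite mul0r subr0 mulr1
  unitr1.
have u3 : a / c * 1 - 0 * P ^+ j \is a GRing.unit.
  by rewrite mul0r subr0 mulr1 unitrM unitrV au.
have -> : (glz (a / c) 0 0 1 * y_elt (p%:R ^+ j) = glz (a / c) 0 (P ^+ j) 1)%g.
  by rewrite -iota_p -/(yZ _) yZE (glz_mul u1 yu); congr glz; ring.
rewrite (glz_mul u3 u2); congr glz; rewrite ?mul1r ?mulr0 ?mul0r ?addr0 //.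
- by rewrite divrK.
- transitivity (b * (c / c) * (a / a)); first by rewrite cV aV !mulr1.
  by ring.
- transitivity (d * (a / a)); first by rewrite aV mulr1.
  by ring.
Qed.

Lemma K0_double_coset_rep n g : K0 n g -> double_coset n (y_elt (p%:R ^+ n)) g.
Proof.
move=> gK; have yK : K0 n (y_elt (p%:R ^+ n)) by apply/y_elt_pK0.
exists (g * (y_elt (p%:R ^+ n))^-1)%g, 1%g; split; last by rewrite mulg1 mulgVK.
- by apply: K0M => //; apply: K0V.
- exact: K01.
Qed.

(** Changing the entries of g by multiples of p^(n+1) keeps the determinant a unit and makes the
    lower-left entry of g^-1 h divisible by p^(n+1). *)
Lemma nbhs_K0_lcoset n g : K0 0 g -> nbhs g [set h | K0 n (g^-1 * h)%g].
Proof.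
move=> /K0E[a [b [c [d []]]]]; rewrite expr0 mul1r => u gE.
(* The exponent n + 1 keeps the change divisible by p even when n = 0. *)
pose B (x : padicQ p_pr) : set (padicQ p_pr) :=
  [set x + p%:R ^+ n.+1 * iota z | z in setT].
have nB x : nbhs x (B x).
  apply: open_nbhs_nbhs; split; last by exists 0;
    rewrite // rmorph0 mulr0 addr0.
  move=> _ [z _ <-]; exists n.+1 => t.
  by exists (z + t) => //; rewrite iotaD mulrDr addrA.
pose N := [set M : 'M[padicQ p_pr]_2 | forall i j, B (GL2val g i j) (M i j)].
have nN : nbhs (GL2val g) N by exists (fun i j => B (GL2val g i j)).
have cont := @initial_continuous G _ (@GL2val (padicQ p_pr)) g N nN.
suff sub : (@GL2val (padicQ p_pr) @^-1` N) `<=` [set h | K0 n (g^-1 * h)%g].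
  exact: (@filterS _ _ (@nbhs_filter G g) _ _ sub cont).
move=> h /= hB.
have [x _ xE] := hB 0 0; have [y _ yE] := hB 0 1.
have [z _ zE] := hB 1 0; have [t _ tE] := hB 1 1.
have hE : GL2val h = mx2 (iota (a + P ^+ n.+1 * x)) (iota (b + P ^+ n.+1 * y))
    (iota (c + P ^+ n.+1 * z)) (iota (d + P ^+ n.+1 * t)).
  rewrite [LHS]mx2_eta -xE -yE -zE -tE gE val_glz // !mxE /=.
  by rewrite !iotaD !iotaM /= !iota_p.
have v : (a + P ^+ n.+1 * x) * (d + P ^+ n.+1 * t) -
    (b + P ^+ n.+1 * y) * (c + P ^+ n.+1 * z) \is a GRing.unit.
  (* The displayed factor of p^(n+1) is the difference of the determinants of h and g. *)
  rewrite -(padic_unitDp _ (a * t + x * d + P ^+ n.+1 * x * t - b * z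
     - y * c - P ^+ n.+1 * y * z) (ltn0Sn n)) in u.
  by congr (_ \is a _): u; ring.
set e := (a * d - b * c)^-1.
have eu : (a * d - b * c) * e = 1 by rewrite mulrV.
have w : e * d * (e * a) - - (e * b) * - (e * c) \is a GRing.unit.
  suff -> : e * d * (e * a) - - (e * b) * - (e * c) = (a * d - b * c) * e * e.
    by rewrite eu mul1r unitrV.
  by ring.
rewrite (glz_eq v hE) gE glz_inv // -/e (glz_mul w v); apply/glz_K0.
  suff -> : forall q r s t q' r' s' t' : Z,
      (q * q' + r * s') * (s * r' + t * t') - (q * r' + r * t') * (s * q' + t
        * s') =
      (q * t - r * s) * (q' * t' - r' * s').
    by rewrite unitrM w.
  by move=> *; ring.
exists (P * e * (a * z - c * x)); rewrite exprSr; ring.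
Qed.

Lemma K0_lcoset_open n g : K0 0 g -> open [set h | K0 n (g^-1 * h)%g].
Proof.
move=> gK; rewrite openE => h /= ghK.
have hK : K0 0 h by rewrite -(mulVKg g h); apply: K0M => //; apply: K0_le ghK.
apply: (@filterS _ _ (@nbhs_filter G h)) (nbhs_K0_lcoset n hK) => k /= hkK.
by rewrite -(mulVKg h k) mulgA; apply: K0M.
Qed.

Lemma K0_open n : open (K0 n).
Proof.
rewrite (_ : K0 n = [set h | K0 n (1^-1 * h)%g]);
  first exact: (K0_lcoset_open n (K01 0)).
by apply/seteqP; split=> h /=; rewrite invg1 mul1g.
Qed.

End LowerLevel.

(** * Volumes and integrals *)

Section Haar.
Variables (R : realType) (p : nat) (p_pr : prime p).
Variable mu : {measure set (borelG p_pr) -> \bar R}.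
Hypothesis mu_haar : is_haar mu.
Local Notation G := (GL2Qp p_pr).
Local Notation K0 := (@K0 p p_pr).
Implicit Types (g h : G).

Lemma measurable_open (U : set G) : open U ->
  measurable (U : set (borelG p_pr)).
Proof. exact: sub_gen_smallest. Qed.

Lemma lcosetE n g : [set h | K0 n (g^-1 * h)%g] = [set (g * h)%g | h in K0 n].
Proof.
apply/seteqP; split=> [h /= hK|_ [h hK <-]] /=; last by rewrite mulKg.
by exists (g^-1 * h)%g => //; rewrite mulVKg.
Qed.

Lemma mu_lcoset n g : mu [set h | K0 n (g^-1 * h)%g] = mu (K0 n).
Proof.
rewrite lcosetE; have [inv _ _] := mu_haar; apply: inv.
by apply: measurable_open; exact: K0_open.
Qed.

(** K_m is the disjoint union of the k left cosets r_i K_n, which are open and have equal volume by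
    left invariance. *)
Lemma mu_K0_index (m n k : nat) (r : nat -> G) (x : R) : (m <= n)%N ->
  (forall i, K0 m (r i)) ->
  (forall g, K0 m g -> exists2 i, (i < k)%N & K0 n ((r i)^-1 * g)%g) ->
  (forall i j, (i < k)%N -> (j < k)%N -> K0 n ((r i)^-1 * r j)%g -> i = j) ->
  mu (K0 n) = x%:E -> mu (K0 m) = (k%:R * x)%:E.
Proof.
move=> mn rK cov disj mux.
pose C (i : 'I_k) : set (borelG p_pr) := [set h | K0 n ((r i)^-1 * h)%g].
have -> : K0 m = \big[setU/set0]_(i < k) C i.
  apply/seteqP; split=> g.
    move=> /cov[i ik iK]; rewrite -bigcup_seq; exists (Ordinal ik) => //=.
    by rewrite mem_index_enum.
  rewrite -bigcup_seq => -[i _ iK]; rewrite -(mulVKg (r i) g).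
  by apply: K0M => //; apply: K0_le iK.
rewrite measure_bigsetU_ord.
- rewrite (eq_bigr (fun=> x%:E)); last by move=> i _; rewrite -mux;
  apply: mu_lcoset.
  by rewrite sumEFin sumr_const card_ord mulr_natl.
- by move=> i; apply: measurable_open; apply: K0_lcoset_open;
  apply: K0_le (rK i).
- move=> i j _ _ [g [/= iK jK]]; apply: val_inj => /=; apply: disj => //.
  rewrite (_ : ((r i)^-1 * r j = ((r i)^-1 * g) * ((r j)^-1 * g)^-1)%g).
    exact: K0M iK (K0V jK).
  by rewrite invgM invgK mulgA mulgK.
Qed.

Lemma mu_K0_step j x : (0 < j)%N -> mu (K0 j.+1) = x%:E ->
  mu (K0 j) = (p%:R * x)%:E.
Proof.
move=> j0 mux.
apply: (@mu_K0_index j j.+1 p (fun i =>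
  yZ (p%:R ^+ j * i%:R : padicZ p_pr)) x _ _ _ _ mux) => //.
- by move=> i; apply/yZ_K0; exists i%:R.
- by move=> g; exact: K0_coset.
- by move=> i i' ip i'p /y_coset_disjoint; apply.
Qed.

Lemma mu_K0_top x : mu (K0 1) = x%:E -> mu (K0 0) = (p.+1%:R * x)%:E.
Proof.
(* The indices below p are the affine points of the projective line; the index p is its point at
   infinity. *)
move=> mux; apply: (@mu_K0_index 0 1 p.+1
  (fun i => if (i < p)%N then yZ (i%:R : padicZ p_pr) else w1_elt _) x _ _ _ _
    mux) => //.
- by move=> i; case: ifP => _; [apply/yZ_K0; exists i%:R;
  rewrite mul1r|apply/w1_K0].
- move=> g /K0_coset0[[i ip iK]|wK]; last first.
    by exists p; [exact: ltnSn | rewrite ltnn; exact: wK].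
  by exists i; [exact: ltnW | rewrite ip; exact: iK].
- move=> i j; rewrite !ltnS => ip jp.
  case: ltnP => i'; case: ltnP => j'.
  + have := @y_coset_disjoint _ p_pr 0 i j i' j'; rewrite expr0 !mul1r; apply.
  + by move=> /w1_coset_disjoint.
  + by move=> /K0V; rewrite invgM invgK => /w1_coset_disjoint.
  + by move=> _; apply/eqP; rewrite eqn_leq (leq_trans ip j') (leq_trans jp i').
Qed.

(** The index of K_n in K_k for k <= n. The value at k = 0 is exceptional because K_0(p) has index p
    + 1 in K, whereas later steps of the chain have index p. *)
Definition K0_vol n k : nat := if k == 0%N then (p ^ n.-1 * p.+1)%N else (p ^
  (n - k))%N.

Lemma mu_K0E n k : (0 < n)%N -> mu (K0 n) = 1%E -> (k <= n)%N ->
  mu (K0 k) = (K0_vol n k)%:R%:E.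
Proof.
(* Starting from volume 1 at level n, each step to a larger group multiplies by p, down to level 1;
   [mu_K0_top] handles the last step. *)
move=> n0 mu1; have pos j : (j < n)%N -> mu (K0 (n - j)) = (p ^ j)%:R%:E.
  elim: j => [|j IH] jn; first by rewrite subn0 expn0.
  rewrite (mu_K0_step (x := (p ^ j)%:R)) ?subn_gt0 //.
    by rewrite expnS natrM.
  by rewrite (subnSK (ltnW jn)) IH // ltnW.
case: k => [_|k kn]; last first.
  by rewrite -[in LHS](subKn kn) pos // ltn_subrL n0.
rewrite (mu_K0_top (x := (p ^ n.-1)%:R)); first by rewrite -natrM mulnC.
by have := pos n.-1; rewrite prednK // leqnn -{1}subn1 subKn //; apply.
Qed.
End Haar.

(** * Linearity of the complex integral *)

Section ComplexIntegral.
Variables (R : realType) (p : nat) (p_pr : prime p).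
Variable mu : {measure set (borelG p_pr) -> \bar R}.
Local Notation C := R[i].
Local Notation G := (GL2Qp p_pr).

Definition Cintegrable (f : G -> C) : Prop :=
  mu.-integrable setT (fun g => (complex.Re (f g))%:E) /\
  mu.-integrable setT (fun g => (complex.Im (f g))%:E).

(** Multiplication by a complex scalar mixes real and imaginary parts, so both must be integrable
    for either part of the result. *)
Lemma CintegralP (a : C) (f1 f2 : G -> C) : Cintegrable f1 -> Cintegrable f2 ->
  Cintegrable (fun g => a * f1 g + f2 g) /\
  Cintegral mu (fun g => a * f1 g + f2 g) =
    a * Cintegral mu f1 + Cintegral mu f2.
Proof.
move=> [r1 i1] [r2 i2]; case: a => x y.
have ReE g : complex.Re (Complex x y * f1 g + f2 g) =
    x * complex.Re (f1 g) + (- y) * complex.Im (f1 g) + complex.Re (f2 g).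
  by case: (f1 g) (f2 g) => [? ?] [? ?] /=; rewrite mulNr.
have ImE g : complex.Im (Complex x y * f1 g + f2 g) =
    x * complex.Im (f1 g) + y * complex.Re (f1 g) + complex.Im (f2 g).
  by case: (f1 g) (f2 g) => [? ?] [? ?].
have iZ (z : R) (f : G -> R) : mu.-integrable setT (EFin \o f) ->
    mu.-integrable setT (EFin \o (fun g => z * f g)).
  by move=> fi; apply: eq_integrable (integrableZl measurableT z fi).
have iD (f g : G -> R) : mu.-integrable setT (EFin \o f) ->
    mu.-integrable setT (EFin \o g) -> mu.-integrable setT (EFin \o (fun h =>
      f h + g h)).
  by move=> fi gi; apply: eq_integrable (integrableD measurableT fi gi).
have RD (f g : G -> R) : mu.-integrable setT (EFin \o f) ->
    mu.-integrable setT (EFin \o g) ->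
    Rintegral mu setT (fun h =>
      f h + g h) = Rintegral mu setT f + Rintegral mu setT g.
  by move=> fi gi; apply: RintegralD.
have RZ (z : R) (f : G -> R) : mu.-integrable setT (EFin \o f) ->
    Rintegral mu setT (fun h => z * f h) = z * Rintegral mu setT f.
  by move=> fi; apply: RintegralZl.
split; first split.
- under eq_fun do rewrite ReE; apply: (iD) => //; apply: (iD); exact: iZ.
- under eq_fun do rewrite ImE; apply: (iD) => //; apply: (iD); exact: iZ.
rewrite /Cintegral; under eq_fun do rewrite ReE;
  under [in X in Complex _ X]eq_fun do rewrite ImE.
rewrite !RD ?RZ //; do ?[exact: iZ | apply: (iD); exact: iZ].
by rewrite mulNr.
Qed.

Lemma Cintegral_indic (A : set G) (x : R) : measurable (A : set (borelG p_pr))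
  ->
  mu A = x%:E ->
  Cintegrable \1_A /\ Cintegral mu \1_A = (x%:C)%C.
Proof.
move=> mA mux.
have ReE g : complex.Re (\1_A g : C) = \1_A g by rewrite !indicE;
  case: (_ \in _).
have ImE g : complex.Im (\1_A g : C) = 0 by rewrite !indicE; case: (_ \in _).
rewrite /Cintegrable /Cintegral;
  under [X in Rintegral mu setT X]eq_fun do rewrite ReE.
under [X in Complex _ (Rintegral mu setT X)]eq_fun do rewrite ImE.
split; first split.
- under eq_fun do rewrite ReE.
  apply/integrableP; split; first by apply/measurable_EFinP;
    apply: measurable_indic.
  rewrite (eq_integral (fun g : borelG p_pr => (\1_A g)%:E)); last first.
    by move=> g _; rewrite gee0_abs // lee_fin.
  by rewrite integral_indic // setIT mux ltry.
- under eq_fun do rewrite ImE.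
  exact: integrable0.
- rewrite /Rintegral integral_indic // setIT mux /=; congr Complex.
  by rewrite integral0.
Qed.
End ComplexIntegral.

(** * Bi-invariant functions *)

Section HeckeLayers.
Variables (R : realType) (p : nat) (p_pr : prime p) (n : nat).
Hypothesis n_gt0 : (0 < n)%N.
Local Notation C := R[i].
Local Notation G := (GL2Qp p_pr).
Local Notation K0 := (@K0 p p_pr).
Local Notation fG := (G -> C^o).
Local Notation H := (@heckeK p p_pr R n).
Implicit Types (f u v : fG) (g h : G).

(* The value 0 at k = n + 1 makes layer k - layer k.+1 the indicator of a double
   coset for all k <= n, including k = n *)
Definition layer k : fG := if (k <= n)%N then \1_(K0 k) else 0.

Lemma fctZE a u g : (a *: u) g = a * u g.
Proof. by []. Qed.

Lemma fctDE u v g : (u + v) g = u g + v g.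
Proof. by []. Qed.

Lemma fctBE u v g : (u - v) g = u g - v g.
Proof. by []. Qed.

Lemma fct_ord_sumE m (F : 'I_m -> fG) g : (\sum_i F i) g = \sum_i F i g.
Proof. exact: (big_morph (fun f : fG => f g) (fun u v => fctDE u v g) erefl).
Qed.

Lemma hecke_subspace : is_subspace H.
Proof.
split; first by split.
move=> a u v [uK u0] [vK v0]; split=> [k1 g k2 k1K k2K|g gK].
  by rewrite !fctDE !fctZE uK // vK.
by rewrite fctDE fctZE u0 // v0 // addr0 mulr0.
Qed.

Lemma layerE k g : (k <= n)%N -> layer k g = (`[< K0 k g >])%:R.
Proof. by rewrite /layer => ->; rewrite indicE; congr ((nat_of_bool _)%:R);
  rewrite inE. Qed.

Lemma K0_mul_iff k g h : K0 k g -> K0 k (g * h)%g <-> K0 k h.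
Proof.
move=> gK; split=> [ghK|hK]; last exact: K0M.
by rewrite -(mulKg g h); apply: K0M ghK; exact: K0V.
Qed.

Lemma K0_mul_iffr k g h : K0 k h -> K0 k (g * h)%g <-> K0 k g.
Proof.
move=> hK; split=> [ghK|gK]; last exact: K0M.
by rewrite -(mulgK h g); apply: K0M ghK _; exact: K0V.
Qed.

Lemma layer_hecke k : H (layer k).
Proof.
have [kn|nk] := leqP k n; last first.
  by rewrite /layer leqNgt nk; have [] := hecke_subspace.
split=> [k1 g k2 k1K k2K|g gK]; rewrite !layerE //.
  have k1K' := K0_le kn k1K; have k2K' := K0_le kn k2K.
  congr ((nat_of_bool _)%:R); apply: asbool_equiv_eq.
  by rewrite K0_mul_iffr // K0_mul_iff.
case: asboolP => // gKk; case: gK.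
by have [] := gKk.
Qed.

Lemma layer_rep i k : (k <= n)%N -> layer i (coset_rep p_pr k) = (i <= k)%:R.
Proof.
move=> kn; have [i_n|ni] := leqP i n; last first.
  by rewrite /layer leqNgt ni /= leqNgt (leq_ltn_trans kn ni).
rewrite layerE //; congr ((nat_of_bool _)%:R).
by apply/asboolP/idP => /coset_rep_K0.
Qed.

Lemma hecke_double_coset f g h : H f -> double_coset n h g -> f g = f h.
Proof. by move=> [fK _] [k1 [k2 [k1K k2K ->]]]; apply: fK. Qed.

(** Descend the chain: either g leaves it between K_k and K_(k+1), where [K0_shell] applies, or it
    reaches K_n, the trivial double coset. *)
Lemma K0_cover g : K0 0 g -> exists2 k,
  (k <= n)%N & double_coset n (coset_rep p_pr k) g.
Proof.
move=> gK; have : forall m, (m <= n)%N ->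
    K0 m g \/ exists2 k, (k <= n)%N & double_coset n (coset_rep p_pr k) g.
  elim=> [|m IH] mn; first by left.
  have [gm|] := IH (ltnW mn); last by right.
  have [gS|gS] := pselect (K0 m.+1 g); first by left.
  by right; exists m; [exact: ltnW | exact: K0_shell].
move/(_ n (leqnn n)) => [gn|//]; exists n => //.
rewrite /coset_rep eqn0Ngt n_gt0; exact: K0_double_coset_rep.
Qed.

Lemma hecke_ext u v : H u -> H v ->
  (forall k, (k <= n)%N -> u (coset_rep p_pr k) = v (coset_rep p_pr k)) ->
    u = v.
Proof.
move=> uH vH uv; apply/funext => g.
(* Level 0 imposes no divisibility on the lower-left entry, so [K0 0] is all of K. *)
have [gK|gK] := pselect (K0 0 g); last first.
  have gK' : ~ GL2Zp g.
    by move=> gZ; apply: gK; have [M _ e] := gZ; split=> //; exists (M 1 0);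
      rewrite expr0 mul1r e mxE.
  by rewrite (uH.2 g gK') (vH.2 g gK').
have [k kn gk] := K0_cover gK.
by rewrite (hecke_double_coset uH gk) (hecke_double_coset vH gk) uv.
Qed.

Lemma heckeZD a u v : H u -> H v -> H (a *: u + v).
Proof. by move=> uH vH; have [_] := hecke_subspace; apply. Qed.

Lemma heckeB u v : H u -> H v -> H (u - v).
Proof. by move=> uH vH; rewrite addrC -scaleN1r; apply: heckeZD. Qed.

Lemma hecke_sum m (F : 'I_m -> fG) (c : 'I_m -> C) : (forall i, H (F i)) ->
  H (\sum_i c i *: F i).
Proof.
move=> FH; apply: big_ind => [|u v uH vH|i _];
  first by have [] := hecke_subspace.
  by rewrite -[u]scale1r; apply: heckeZD.
by rewrite -[_ *: _]addr0; apply: heckeZD => //; have [] := hecke_subspace.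
Qed.

(** Differences of consecutive layers are dual to evaluation at the representatives; this yields
    both independence and coordinates. *)
Lemma shell_rep j k : (k <= n)%N ->
  (layer j - layer j.+1) (coset_rep p_pr k) = (j == k)%:R.
Proof.
move=> kn; rewrite fctBE !layer_rep //.
by case: ltngtP => _ /=; rewrite ?subrr ?subr0.
Qed.

Lemma sum_shell_rep (c : 'I_n.+1 -> C) (k : 'I_n.+1) :
  (\sum_j c j *: (layer j - layer j.+1)) (coset_rep p_pr k) = c k.
Proof.
have kn : (k <= n)%N by rewrite -ltnS.
rewrite fct_ord_sumE (bigD1 k) //= fctZE shell_rep // eqxx mulr1.
rewrite big1 ?addr0 // => j jk.
have /negPf jk' : nat_of_ord j != k by [].
by rewrite fctZE shell_rep // jk' mulr0.
Qed.

Lemma hecke_expand f : H f ->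
  f = \sum_(j < n.+1) f (coset_rep p_pr j) *: (layer j - layer j.+1).
Proof.
move=> fH; apply: hecke_ext => //.
  by apply: hecke_sum => j; apply: heckeB; exact: layer_hecke.
move=> k kn; rewrite -ltnS in kn.
by rewrite (sum_shell_rep (fun j => f (coset_rep p_pr j)) (Ordinal kn)).
Qed.

(** The layers span, so multilinear identities need checking only on them. *)
Lemma hecke_ind (Q : fG -> Prop) :
  (forall a u v, H u -> H v -> Q u -> Q v -> Q (a *: u + v)) ->
  (forall i, (i <= n)%N -> Q (layer i)) -> forall f, H f -> Q f.
Proof.
move=> QD Ql f fH.
have H0 : H 0 by have [] := hecke_subspace.
have Q0 : Q 0.
  (* Zero is obtained as layer 0 minus itself. *)
  have := QD (-1) _ _ (layer_hecke 0) (layer_hecke 0) (Ql 0%N isT) (Ql 0%N isT).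
  by rewrite scaleN1r addNr.
(* The index n + 1 occurs in the last difference, where the layer is 0. *)
have HQ i : H (layer i) /\ Q (layer i).
  split; first exact: layer_hecke.
  have [i_n|ni] := leqP i n; first exact: Ql.
  by rewrite /layer leqNgt ni.
suff [] : H f /\ Q f by [].
rewrite (hecke_expand fH);
  apply: (big_ind (fun f => H f /\ Q f)) => [//|u v [uH uQ] [vH vQ]|j _].
  by rewrite -[u]scale1r; split; [exact: heckeZD | exact: QD].
rewrite -[_ *: _]addr0; have [Hj Qj] := HQ j; have [Hj' Qj'] := HQ j.+1.
have HQs : H (layer j - layer j.+1) /\ Q (layer j - layer j.+1).
  by rewrite addrC -scaleN1r; split; [exact: heckeZD | exact: QD].
by split; [apply: heckeZD | apply: QD] => //; case: HQs.
Qed.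

(** The difference is 1 on its own double coset; by [K0_cover] any other point of K lies in a
    different one, where it vanishes. *)
Lemma double_coset_layer j : (j <= n)%N ->
  \1_(double_coset n (coset_rep p_pr j)) = layer j - layer j.+1.
Proof.
move=> jn; apply/funext => g; rewrite indicE.
have sH := heckeB (layer_hecke j) (layer_hecke j.+1).
case: (boolP (g \in _)) => [|/negP]; rewrite inE => gj.
  by rewrite (hecke_double_coset sH gj) shell_rep // eqxx.
have [gK|gK] := pselect (K0 0 g); last first.
  rewrite sH.2 // => gZ; apply: gK; have [M _ e] := gZ; split=> //.
  by exists (M 1 0); rewrite expr0 mul1r e mxE.
have [k kn gk] := K0_cover gK.
rewrite (hecke_double_coset sH gk) shell_rep //.
by case: eqVneq => // jk; case: gj; rewrite jk.
Qed.

Lemma unitI_layer : @unitI p p_pr R n = layer n.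
Proof. by rewrite /layer leqnn. Qed.

Lemma opU0_layer : @opU0 p p_pr R n = layer 0 - layer 1.
Proof. exact: (double_coset_layer (leq0n n)). Qed.

Lemma opV_layer j : (0 < j <= n)%N -> @opV p p_pr R n j = layer j - layer j.+1.
Proof.
move=> /andP[j0 jn]; rewrite -(double_coset_layer jn) /coset_rep.
by rewrite eqn0Ngt j0.
Qed.

(** The sum of the V_j telescopes to layer r minus layer n, and I is layer n. *)
Lemma opY_layer r : (1 <= r <= n)%N -> @opY p p_pr R n r = layer r.
Proof.
move=> /andP[r1 rn]; rewrite /opY unitI_layer.
rewrite (eq_big_nat _ _ (F2 := fun j => - (layer j.+1 - layer j))); last first.
  by move=> j /andP[rj jn]; rewrite opV_layer ?opprB // (leq_trans r1 rj) ltnW.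
by rewrite sumrN telescope_sumr // opprB addrC subrK.
Qed.

End HeckeLayers.

(** * Convolution *)

Section HeckeAlgebra.
Variables (R : realType) (p : nat) (p_pr : prime p) (n : nat).
Hypothesis n_gt0 : (0 < n)%N.
Variable mu : {measure set (borelG p_pr) -> \bar R}.
Hypothesis mu_haar : is_haar mu.
Hypothesis mu_K0n : mu (@K0 p p_pr n) = 1%E.
Local Notation C := R[i].
Local Notation G := (GL2Qp p_pr).
Local Notation K0 := (@K0 p p_pr).
Local Notation fG := (G -> C^o).
Local Notation H := (@heckeK p p_pr R n).
Local Notation conv := (@convol p p_pr R mu).
Local Notation layer := (@layer R p p_pr n).
Local Notation vol := (K0_vol p n).
Implicit Types (f u v w : fG) (g h : G).

(* A is the intersection of K0 i and h (K0 j): as the groups are nested, it is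
   empty or a left coset of the smaller group *)
Lemma mu_K0_meet i j h : (i <= n)%N -> (j <= n)%N ->
  let A := K0 i `&` [set g | K0 j (g^-1 * h)%g] in
  measurable (A : set (borelG p_pr)) /\
  mu A = ((vol (maxn i j))%:R * \1_(K0 (minn i j)) h)%:E.
Proof.
move=> i_n jn A.
(* Inverting g^-1 h exhibits the second set as the left coset h K_j. *)
have AE : A = K0 i `&` [set g | K0 j (h^-1 * g)%g].
  apply/seteqP; split=> g [gi /= gj]; split=> //=.
    by rewrite -(invgK (h^-1 * g)%g) invgM invgK; exact: K0V.
  by rewrite -(invgK (g^-1 * h)%g) invgM invgK; exact: K0V.
have volE k : (k <= n)%N -> mu (K0 k) = (vol k)%:R%:E by move=> ?;
  exact: mu_K0E.
have [hK|hK] := pselect (K0 (minn i j) h); last first.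
  have -> : A = set0.
    rewrite AE; apply/seteqP; split=> // g [gi /= gj]; apply: hK.
    have -> : (h = g * (h^-1 * g)^-1)%g by rewrite invgM invgK mulVKg.
    apply: K0M; first exact: K0_le (geq_minl _ _) gi.
    exact: K0V (K0_le (geq_minr _ _) gj).
  rewrite measure0 indicE memNset // mulr0; split=> //; exact: measurable0.
rewrite indicE mem_set // mulr1.
have [ij|/ltnW ji] := leqP i j.
  rewrite (minn_idPl ij) in hK.
  have -> : A = [set g | K0 j (h^-1 * g)%g].
    rewrite AE; apply/seteqP; split=> g; first by case.
    move=> gj; split=> //.
    by rewrite -(mulVKg h g); exact: (K0M hK (K0_le ij gj)).
  rewrite mu_lcoset // volE //; split=> //.
  by apply: measurable_open; apply: K0_lcoset_open; exact: (K0_le (leq0n i) hK).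
rewrite (minn_idPr ji) in hK.
have -> : A = K0 i.
  rewrite AE; apply/seteqP; split=> g; first by case.
  by move=> gi; split=> //=; exact: (K0M (K0V hK) (K0_le ji gi)).
rewrite volE //; split=> //.
by apply: measurable_open; exact: K0_open.
Qed.

Lemma conv_layer_integrand i j h : (i <= n)%N -> (j <= n)%N ->
  (fun g => layer i g * layer j (g^-1 * h)%g) =
  \1_(K0 i `&` [set g | K0 j (g^-1 * h)%g]) :> (G -> C).
Proof.
move=> i_n jn; apply/funext => g;
  rewrite !layerE // indicE -natrM mulnb -asbool_and.
by congr ((nat_of_bool _)%:R); rewrite inE.
Qed.

(** The multiplication table: the integrand is the indicator of the set measured in [mu_K0_meet]. *)
Lemma conv_layer i j : (i <= n)%N -> (j <= n)%N ->
  conv (layer i) (layer j) = (vol (maxn i j))%:R *: layer (minn i j).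
Proof.
move=> i_n jn; apply/funext => h.
have [mA muA] := mu_K0_meet h i_n jn.
rewrite /convol (conv_layer_integrand h i_n jn) (Cintegral_indic mA muA).2.
rewrite fctZE layerE; last by rewrite geq_min i_n.
by rewrite indicE rmorphM !rmorph_nat.
Qed.

(** Linearity of convolution rests on integrability, so the reduction to layers is made here on the
    integrand itself. *)
Lemma conv_integrable u v h : H u -> H v ->
  Cintegrable mu (fun g => u g * v (g^-1 * h)%g).
Proof.
move=> uH vH; move: u uH; apply: (hecke_ind n_gt0) => [a u1 u2 _ _ I1 I2|i i_n].
  rewrite (_ : (fun g => _) = fun g =>
    a * (u1 g * v (g^-1 * h)%g) + u2 g * v (g^-1 * h)%g).
    exact: (CintegralP a I1 I2).1.
  by apply/funext => g; rewrite fctDE fctZE mulrDl mulrA.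
move: v vH; apply: (hecke_ind n_gt0) => [a v1 v2 _ _ I1 I2|j jn].
  rewrite (_ : (fun g => _) = fun g =>
    a * (layer i g * v1 (g^-1 * h)%g) + layer i g * v2 (g^-1 * h)%g).
    exact: (CintegralP a I1 I2).1.
  by apply/funext => g; rewrite fctDE fctZE mulrDr mulrCA.
rewrite (conv_layer_integrand h i_n jn); have [mA muA] := mu_K0_meet h i_n jn.
exact: (Cintegral_indic mA muA).1.
Qed.

Lemma conv_linear_l a u v w : H u -> H v -> H w ->
  conv (a *: u + v) w = a *: conv u w + conv v w.
Proof.
move=> uH vH wH; apply/funext => h; rewrite fctDE fctZE.
rewrite /convol -(CintegralP a (conv_integrable h uH wH) (conv_integrable h vH
  wH)).2.
by congr (Cintegral mu); apply/funext => g; rewrite fctDE fctZE mulrDl mulrA.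
Qed.

Lemma conv_linear_r a u v w : H u -> H v -> H w ->
  conv w (a *: u + v) = a *: conv w u + conv w v.
Proof.
move=> uH vH wH; apply/funext => h; rewrite fctDE fctZE.
rewrite /convol -(CintegralP a (conv_integrable h wH uH) (conv_integrable h wH
  vH)).2.
by congr (Cintegral mu); apply/funext => g; rewrite fctDE fctZE mulrDr mulrCA.
Qed.

Lemma conv_hecke u v : H u -> H v -> H (conv u v).
Proof.
move=> uH vH; move: u uH;
  apply: (hecke_ind n_gt0) => [a u1 u2 H1 H2 I1 I2|i i_n].
  by rewrite conv_linear_l //; exact: heckeZD.
move: v vH; apply: (hecke_ind n_gt0) => [a v1 v2 H1 H2 I1 I2|j jn].
  by rewrite conv_linear_r //; [exact: heckeZD | exact: layer_hecke].
rewrite conv_layer // -[_ *: _]addr0; apply: heckeZD; first exact: layer_hecke.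
by have [] := hecke_subspace R p_pr n.
Qed.

Lemma conv_comm : is_commutative H conv.
Proof.
move=> u v uH vH; move: u uH;
  apply: (hecke_ind n_gt0) => [a u1 u2 H1 H2 I1 I2|i i_n].
  by rewrite conv_linear_l // conv_linear_r // I1 I2.
move: v vH; apply: (hecke_ind n_gt0) => [a v1 v2 H1 H2 I1 I2|j jn].
  have li := layer_hecke R p_pr n i.
  by rewrite conv_linear_l // conv_linear_r // I1 I2.
by rewrite !conv_layer // maxnC minnC.
Qed.

Lemma conv_scale_l a u w : H u -> H w -> conv (a *: u) w = a *: conv u w.
Proof.
move=> uH wH; have H0 : H 0 by have [] := hecke_subspace R p_pr n.
have e0 : conv 0 w = 0.
  have := conv_linear_l (-1) H0 H0 wH.
  by rewrite !scaleN1r addNr => ->; rewrite addNr.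
by rewrite -[a *: u]addr0 conv_linear_l // e0 addr0.
Qed.

Lemma conv_scale_r a u w : H u -> H w -> conv w (a *: u) = a *: conv w u.
Proof.
move=> uH wH; have aH : H (a *: u).
  by rewrite -[_ *: _]addr0; apply: heckeZD => //;
    have [] := hecke_subspace R p_pr n.
by rewrite conv_comm // conv_scale_l // conv_comm.
Qed.

(** On three layers both sides are the layer of least index times the product of the volumes at the
    two larger indices. *)
Lemma conv_assoc u v w : H u -> H v -> H w ->
  conv u (conv v w) = conv (conv u v) w.
Proof.
move=> uH vH wH; have lH i := layer_hecke R p_pr n i.
move: u uH; apply: (hecke_ind n_gt0) => [a u1 u2 H1 H2 I1 I2|i i_n].
  rewrite (conv_linear_l a H1 H2 (conv_hecke vH wH)) (conv_linear_l a H1 H2 vH).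
  by rewrite (conv_linear_l a (conv_hecke H1 vH) (conv_hecke H2 vH) wH) I1 I2.
move: v vH; apply: (hecke_ind n_gt0) => [a v1 v2 H1 H2 I1 I2|j jn].
  rewrite (conv_linear_l a H1 H2 wH) (conv_linear_r a H1 H2 (lH i)).
  rewrite (conv_linear_r a (conv_hecke H1 wH) (conv_hecke H2 wH) (lH i)).
  by rewrite (conv_linear_l a (conv_hecke (lH i) H1) (conv_hecke (lH i) H2)
    wH) I1 I2.
move: w wH; apply: (hecke_ind n_gt0) => [a w1 w2 H1 H2 I1 I2|k kn].
  rewrite (conv_linear_r a H1 H2 (lH j)) (conv_linear_r a H1 H2 (conv_hecke
    (lH i) (lH j))).
  by rewrite (conv_linear_r a (conv_hecke (lH j) H1) (conv_hecke (lH j) H2)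
    (lH i)) I1 I2.
have min_n a b : (a <= n)%N -> (minn a b <= n)%N by move=> an;
  rewrite geq_min an.
rewrite !conv_layer // conv_scale_r // conv_scale_l // !conv_layer ?min_n //.
rewrite !scalerA -!natrM minnA; congr (_%:R *: _).
case: (leqP i j) => [ij|/ltnW ji]; case: (leqP j k) => [jk|/ltnW kj].
- by rewrite (maxn_idPr ij) (maxn_idPr (leq_trans ij jk)) mulnC.
- by [].
- by rewrite (maxn_idPl ji) mulnC.
- by rewrite (maxn_idPl (leq_trans kj ji)) mulnC.
Qed.

Lemma vol_pos k : (0 < k)%N -> vol k = (p ^ (n - k))%N.
Proof. by case: k. Qed.

Lemma conv_unitI u : H u -> conv (unitI R n) u = u.
Proof.
rewrite unitI_layer; move: u;
  apply: (hecke_ind n_gt0) => [a u1 u2 H1 H2 I1 I2|i i_n].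
  by rewrite conv_linear_r ?I1 ?I2 //; exact: layer_hecke.
by rewrite conv_layer // (maxn_idPl i_n) (minn_idPr i_n) vol_pos // subnn
  scale1r.
Qed.

End HeckeAlgebra.

(** * Relations and presentation *)

Section HeckeRelations.
Variables (R : realType) (p : nat) (p_pr : prime p) (n : nat).
Hypothesis n_gt0 : (0 < n)%N.
Variable mu : {measure set (borelG p_pr) -> \bar R}.
Hypothesis mu_haar : is_haar mu.
Hypothesis mu_K0n : mu (@K0 p p_pr n) = 1%E.
Local Notation C := R[i].
Local Notation G := (GL2Qp p_pr).
Local Notation fG := (G -> C^o).
Local Notation H := (@heckeK p p_pr R n).
Local Notation conv := (@convol p p_pr R mu).
Local Notation layer := (@layer R p p_pr n).
Local Notation vol := (K0_vol p n).
Local Notation I := (@unitI p p_pr R n).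
Local Notation U0 := (@opU0 p p_pr R n).
Local Notation Y := (@opY p p_pr R n).
Implicit Types (f u v w : fG) (g h : G).

Let lH k : H (layer k) := layer_hecke R p_pr n k.
Let conv_lin_l := conv_linear_l n_gt0 mu_haar mu_K0n.
Let conv_lin_r := conv_linear_r n_gt0 mu_haar mu_K0n.
Let conv_ll := conv_layer n_gt0 mu_haar mu_K0n.

Lemma U0_hecke : H U0.
Proof. by rewrite opU0_layer //; apply: heckeB. Qed.

Lemma vol0E : (vol 0)%:R = p%:R ^+ (n - 1) * (p%:R + 1) :> C.
Proof. by rewrite /K0_vol /= subn1 natrM natrX -addn1 natrD. Qed.

Lemma volXE k : (0 < k)%N -> (vol k)%:R = p%:R ^+ (n - k) :> C.
Proof. by move=> k0; rewrite vol_pos // natrX. Qed.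

Lemma pXE : p%:R ^+ n = p%:R * p%:R ^+ (n - 1) :> C.
Proof. by rewrite -exprS subn1 prednK. Qed.

Lemma conv_layer_le i j : (i <= j <= n)%N ->
  conv (layer i) (layer j) = (vol j)%:R *: layer i /\
  conv (layer j) (layer i) = (vol j)%:R *: layer i.
Proof.
move=> /andP[ij jn]; have i_n := leq_trans ij jn.
by rewrite !conv_ll // (maxn_idPr ij) (maxn_idPl ij) (minn_idPl ij) (minn_idPr
  ij).
Qed.

Lemma U0E : U0 = (-1) *: layer 1 + layer 0.
Proof. by rewrite opU0_layer // scaleN1r addrC. Qed.

(** U_0 combines layers 0 and 1, of index at most k, so layer k multiplies both by its volume. *)
Lemma conv_U0_layer k : (1 <= k <= n)%N ->
  conv U0 (layer k) = p%:R ^+ (n - k) *: U0 /\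
  conv (layer k) U0 = p%:R ^+ (n - k) *: U0.
Proof.
move=> kn; have [k1 k_n] := andP kn; have lU := U0_hecke.
suff e : conv U0 (layer k) = p%:R ^+ (n - k) *: U0.
  by rewrite (conv_comm n_gt0 mu_haar mu_K0n (lH k) lU) e.
rewrite {1}U0E (conv_lin_l (-1) (lH 1) (lH 0) (lH k)).
rewrite (conv_layer_le kn).1 (conv_layer_le (i := 0) k_n).1 volXE // U0E.
by rewrite scalerDr !scalerA mulrC.
Qed.

(** U_0 * d_0 = (vol(K) - vol(K_1)) d_0 = p^n (U_0 + d_1), from which U_0 * d_1 = p^(n-1) U_0 is
    subtracted. *)
Lemma conv_U0_U0 :
  conv U0 U0 = (p%:R ^+ (n - 1) * (p%:R - 1)) *: U0 + p%:R ^+ n *: layer 1.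
Proof.
rewrite {2}U0E (conv_lin_r (-1) (lH 1) (lH 0) U0_hecke).
rewrite (conv_U0_layer (k := 1) n_gt0).1 {2}U0E.
rewrite (conv_lin_l (-1) (lH 1) (lH 0) (lH 0)).
rewrite (conv_layer_le (i := 0) (j := 1) n_gt0).2 (conv_layer_le (i := 0) (j
  := 0) (leq0n n)).1.
rewrite vol0E volXE // pXE U0E; apply/funext => g.
by rewrite !(fctDE, fctZE); ring.
Qed.

Lemma hecke_relations_conv : hecke_relations p n conv I U0 Y.
Proof.
have U1 := U0_hecke.
split.
- move=> r /andP[_ rn];
  have rn' : (r < n)%N by rewrite -(prednK n_gt0) ltnS -subn1.
  have nr : (1 <= n - r <= n)%N by rewrite subn_gt0 rn' leq_subr.
  have nn : (n - r <= n - r <= n)%N by rewrite leqnn leq_subr.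
  rewrite !opY_layer // (conv_layer_le nn).1.
  by rewrite volXE ?subn_gt0 // subKn // ltnW.
- move=> r l /andP[l1 lr] rn; have r1 := leq_trans l1 lr.
  rewrite !opY_layer ?l1 ?r1 ?(leq_trans lr) // -volXE //.
  have lrn : (l <= r <= n)%N by rewrite lr.
  by have [-> ->] := conv_layer_le lrn.
- by rewrite conv_U0_U0 opY_layer // n_gt0.
- by move=> r rn; rewrite opY_layer //; exact: conv_U0_layer.
have IH : H I by rewrite unitI_layer.
have UI : conv U0 I = U0.
  by rewrite unitI_layer (conv_U0_layer (k := n) _).1 ?n_gt0 ?leqnn // subnn
    scale1r.
(* By the quadratic relation U_0 * (U_0 - p^n) = - q U_0 + p^n Y_1 with q = p^(n-1); multiplying by
   U_0 + q then cancels every term. *)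
pose q : C := p%:R ^+ (n - 1).
have -> : conv U0 (U0 - p%:R ^+ n *: I) = (- q) *: U0 + (p%:R ^+ n *: layer 1).
  rewrite [U0 - _]addrC -scaleNr (conv_lin_r _ IH U1 U1) UI conv_U0_U0 pXE -/q.
  by apply/funext => g; rewrite !(fctDE, fctZE); ring.
have L1 : H (p%:R ^+ n *: layer 1).
  by rewrite -[_ *: _]addr0; apply: heckeZD => //;
    have [] := hecke_subspace R p_pr n.
rewrite [U0 + _]addrC (conv_lin_r _ IH U1); last exact: heckeZD.
rewrite !(conv_lin_l _ U1 L1) // UI conv_U0_U0.
rewrite !(conv_scale_l n_gt0 mu_haar mu_K0n) //.
rewrite (conv_U0_layer (k := 1) n_gt0).2 unitI_layer.
have n1 : (1 <= n <= n)%N by rewrite n_gt0 leqnn.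
rewrite (conv_layer_le n1).1 volXE // subnn pXE -/q.
by apply/funext => g; rewrite !(fctDE, fctZE) [(0 : fG) g]/0; ring.
Qed.

Lemma hecke_is_algebra : is_algebra H conv I.
Proof.
have IH : H I by rewrite unitI_layer.
split; split.
- exact: hecke_subspace.
- exact: IH.
- by move=> u v; exact: conv_hecke.
- by move=> a u v w; exact: conv_lin_l.
- by move=> a u v w; exact: conv_lin_r.
- by move=> u v w; exact: conv_assoc.
- move=> u uH; have e := conv_unitI n_gt0 mu_haar mu_K0n uH.
  by split=> //; rewrite (conv_comm n_gt0 mu_haar mu_K0n uH IH).
Qed.

(** The basis consists of the n + 1 double-coset indicators, with values at the representatives as
    coordinates. *)
Lemma hecke_dimension : has_dimension H n.+1.
Proof.
exists (fun j : 'I_n.+1 => layer j - layer j.+1); split.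
- by move=> j; exact: heckeB.
- move=> c c0 k; have kn : (k <= n)%N by rewrite -ltnS.
  by have := sum_shell_rep p_pr c k; rewrite c0.
- move=> f fH; exists (fun j : 'I_n.+1 => f (coset_rep p_pr j)).
  exact: hecke_expand.
Qed.

Lemma hecke_generated : generates H conv I
  [set f | f = U0 \/ exists2 r, (1 <= r <= n)%N & f = Y r].
Proof.
split=> [f [->|[r rn ->]]|S [S0 SD] SI SM XS f].
- exact: U0_hecke.
- by rewrite opY_layer.
apply: hecke_ind => // [a u v _ _|[|i] i_n]; first exact: SD.
  have SU : S U0 by apply: XS; left.
  have SY : S (Y 1) by apply: XS; right; exists 1%N.
  (* Layer 0 is the only layer that is not itself a generator. *)
  rewrite (_ : layer 0 = 1 *: U0 + Y 1); first exact: SD.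
  by rewrite scale1r opU0_layer // opY_layer ?n_gt0 // subrK.
apply: XS; right; exists i.+1 => //.
by rewrite opY_layer.
Qed.

(** * The universal property of the relations *)

Section Presentation.
Variables (A : algType C) (u : A) (y : nat -> A).
Hypothesis yn : y n = 1.
Hypothesis rel : hecke_relations p n *%R 1 u y.

(* The relations force these images, as layer 0 = U0 + Y 1 and layer k = Y k *)
Definition layer_image k : A :=
  if k == 0%N then u + y 1%N else if (k <= n)%N then y k else 0.

(** The table of [conv_layer_le], now in A; the quadratic relation enters for i = j = 0. *)
Lemma layer_image_mul i j : (i <= j <= n)%N ->
  layer_image i * layer_image j =
    (vol j)%:R *: layer_image i /\ layer_image j * layer_image i =
    (vol j)%:R *: layer_image i.
Proof.
have [_ ryy ruu ruy _] := rel.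
case: i => [|i]; case: j => [|j] //.
- move=> _; rewrite /layer_image /= mulrDl !mulrDr ruu vol0E.
  have n1 : (1 <= 1 <= n)%N by rewrite n_gt0.
  have [-> ->] := ruy 1%N n1; have [-> _] := ryy 1%N 1%N isT n_gt0.
  suff -> : (p%:R ^+ (n - 1) * (p%:R - 1)) *: u + p%:R ^+ n *: y 1%N + p%:R ^+
    (n - 1) *: u
    + (p%:R ^+ (n - 1) *: u + p%:R ^+ (n - 1) *: y 1%N) =
    (p%:R ^+ (n - 1) * (p%:R + 1)) *: (u + y 1%N) by [].
  have collect (a b q : C) : a *: u + b *: y 1%N + q *: u + (q *: u + q *: y
    1%N) =
      (a + q + q) *: u + (b + q) *: y 1%N.
    rewrite !scalerDl -!addrA; congr (_ + _).
    by rewrite addrCA; congr (_ + _); rewrite addrCA.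
  by rewrite collect pXE scalerDr; congr (_ *: _ + _ *: _); ring.
- move=> jn'; have jn : (j.+1 <= n)%N by [].
  rewrite /layer_image /= jn volXE // mulrDl mulrDr.
  have [-> ->] := ruy j.+1 jn; have [-> ->] := ryy j.+1 1%N isT jn.
  by rewrite -scalerDr.
- move=> /andP[ij jn]; have i_n := leq_trans ij jn.
  by rewrite /layer_image /= i_n jn volXE //;
    have [-> ->] := ryy j.+1 i.+1 ij jn.
Qed.

(** The expansion of [hecke_expand] with layers replaced by their images. The formula makes sense
    for every function f, hence is linear without restriction. *)
Definition presentation_map (f : fG) : A :=
  \sum_(j < n.+1) f (coset_rep p_pr j) *: (layer_image j - layer_image j.+1).

Lemma presentation_map_linear a v w : presentation_map (a *: v + w) =
  a *: presentation_map v + presentation_map w.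
Proof.
rewrite /presentation_map scaler_sumr -big_split; apply: eq_bigr => j _.
by rewrite fctDE fctZE scalerDl scalerA.
Qed.

(** Only the terms j >= i survive; they telescope to the image at i minus the one at n + 1, which is
    0 by convention. *)
Lemma presentation_map_layer i : (i <= n)%N ->
  presentation_map (layer i) = layer_image i.
Proof.
move=> i_n; rewrite /presentation_map.
rewrite (eq_bigr (fun j : 'I_n.+1 =>
  if (i <= j)%N then layer_image j - layer_image j.+1 else 0)); last first.
  move=> j _; have jn : (j <= n)%N by rewrite -ltnS.
  rewrite (layer_rep R p_pr i jn).
  by case: (i <= j)%N; rewrite ?scale1r ?scale0r.
rewrite -big_mkcond -(big_geq_mkord i n.+1 xpredT (fun j =>
  layer_image j - layer_image j.+1)).
rewrite (eq_bigr (fun j => - (layer_image j.+1 - layer_image j)));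
  last by move=> j _; rewrite opprB.
rewrite sumrN telescope_sumr ?leqW // opprB {2}/layer_image /= ltnn subr0 //.
Qed.

(** By bilinearity this compares two multiplication tables on layers, which agree. *)
Lemma presentation_map_mul v w : H v -> H w ->
  presentation_map (conv v w) = presentation_map v * presentation_map w.
Proof.
move=> vH wH; move: v vH;
  apply: (hecke_ind n_gt0) => [a v1 v2 H1 H2 I1 I2|i i_n].
  by rewrite (conv_lin_l a H1 H2 wH) !presentation_map_linear I1 I2 mulrDl
    scalerAl.
move: w wH; apply: (hecke_ind n_gt0) => [a w1 w2 H1 H2 I1 I2|j jn].
  by rewrite (conv_lin_r a H1 H2 (lH i)) !presentation_map_linear I1 I2 mulrDr
    scalerAr.
have pZ a v : presentation_map (a *: v) = a *: presentation_map v.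
  rewrite -[a *: v]addr0 presentation_map_linear (_ : presentation_map 0 =
    0) ?addr0 //.
  by apply: big1 => k _; exact: scale0r.
rewrite conv_ll // pZ !presentation_map_layer ?geq_min ?i_n //.
case: (leqP i j) => [ij|/ltnW ji].
  have ijn : (i <= j <= n)%N by rewrite ij.
  by have [-> _] := layer_image_mul ijn.
have jin : (j <= i <= n)%N by rewrite ji.
by have [_ ->] := layer_image_mul jin.
Qed.

Lemma hecke_presentation : exists phi : fG -> A,
  [/\ is_algebra_morphism H conv I phi, phi U0 = u &
      forall r, (1 <= r <= n)%N -> phi (Y r) = y r].
Proof.
have layer_imageE k : (1 <= k <= n)%N -> layer_image k = y k.
  by rewrite /layer_image => /andP[k1 ->]; rewrite eqn0Ngt k1.
exists presentation_map; split.
- split.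
  + by move=> a v w _ _; exact: presentation_map_linear.
  + by move=> v w; exact: presentation_map_mul.
  (* The unit is layer n, sent to y_n, which is 1 by [yn]. *)
  + by rewrite unitI_layer presentation_map_layer // layer_imageE ?n_gt0 ?leqnn.
- rewrite U0E presentation_map_linear !presentation_map_layer // scaleN1r
  layer_imageE ?n_gt0 //.
  by rewrite /layer_image /= addrC addrK.
- by move=> r rn; have [_ r_n] := andP rn;
  rewrite opY_layer // presentation_map_layer // layer_imageE.
Qed.
End Presentation.
End HeckeRelations.

(** The last clause says that the relations are defining: elements of any algebra satisfying them
    receive a morphism from H, whose values on H are determined because the generators generate. *)
Theorem theorem6 (R : realType) (p : nat) (p_pr : prime p) (n : nat)
    (n_ge2 : (2 <= n)%N) (mu : {measure set (borelG p_pr) -> \bar R})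
    (mu_haar : is_haar mu) (mu_K0 : mu (@K0 p p_pr n) = 1%E) :
  let H := @heckeK p p_pr R n in
  let conv := @convol p p_pr R mu in
  let I := @unitI p p_pr R n in
  let U0 := @opU0 p p_pr R n in
  let Y := @opY p p_pr R n in
  [/\ is_algebra H conv I /\ is_commutative H conv,
      has_dimension H n.+1,
      generates H conv I
        [set f | f = U0 \/ exists2 r, (1 <= r <= n)%N & f = Y r],
      hecke_relations p n conv I U0 Y &
      forall (A : algType R[i]) (u : A) (y : nat -> A),
        y n = 1 -> hecke_relations p n *%R 1 u y ->
        exists phi : (GL2Qp p_pr -> R[i]^o) -> A,
          [/\ is_algebra_morphism H conv I phi, phi U0 = u &
              forall r, (1 <= r <= n)%N -> phi (Y r) = y r]].
Proof.
have n_gt0 : (0 < n)%N by apply: leq_trans n_ge2.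
move=> H conv I U0 Y; split.
- by split; [exact: hecke_is_algebra | exact: conv_comm].
- exact: hecke_dimension.
- exact: hecke_generated.
- exact: hecke_relations_conv.
- by move=> A u y yn rel; exact: hecke_presentation.
Qed.
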